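(* Let $\lambda:U\to R^*$ be a group homomorphism such that $P(\lambda)=G$, i.e. $\lambda$ is non-trivial on every fundamental root subgroup $X_{i,i+1}$, $1\le i<n$. Then $E_\lambda$ and $F_\lambda$ respectively generate $I$ and $L$, i.e. $I=RG\cdot E_\lambda$ and $L=KG\cdot F_\lambda$.
   Context: Let $n\ge 2$ and $G=\mathrm{GL}_n(q)$, the general linear group over the finite field $F_q$ of characteristic $p$. Let $\ell\ne p$ be a prime, and let $R$ be a local principal ideal domain of characteristic $0$ with maximal ideal $\ell R$, containing a primitive $p$-th root of unity; $R^*$ is its unit group and $K=R/\ell R$. Modules are left modules. $B$ is the group of upper triangular matrices in $G$ and $U$ the group of upper unitriangular matrices; $S_n$ is viewed as the subgroup of permutation matrices of $G$; $\widehat{S}=\sum_{s\in S}s\in RG$ for $S\subseteq G$. Put $\varepsilon=\sum_{\sigma\in S_n}\mathrm{sg}(\sigma)\,\sigma\widehat{B}\in RG$. The Steinberg lattice is the left ideal $I=RG\cdot\varepsilon$, and $L=I/\ell I$, a $KG$-module. For a group homomorphism $\lambda:U\to R^*$, $P(\lambda)$ is the subgroup of $G$ generated by $B$ and the transpositions $(i,i+1)$, $1\le i<n$, such that $\lambda$ is non-trivial on $X_{i,i+1}=\{I_n+aE^{i,i+1} : a\in F_q\}$. Put $E_\lambda=\sum_{u\in U}\lambda(u)u\varepsilon\in I$ and $F_\lambda=E_\lambda+\ell I\in L$. *)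

(* Defs.v *)
From HB Require Import structures.
From mathcomp Require Import all_boot all_order all_algebra all_fingroup.
From mathcomp Require Import ring_quotient.
From mathcomp Require Import boolp.

Set Implicit Arguments.
Unset Strict Implicit.
Unset Printing Implicit Defensive.

Import GRing.Theory.
Local Open Scope ring_scope.
Local Open Scope quotient_scope.

(* An [idealr] is a proper ideal, given by a boolean predicate; with classical *)
(* logic every proper ideal is of this form. The unit ideal needs no mention:  *)
(* it is principal and not maximal.                                            *)
Definition principal_ideal_domain (R : idomainType) : Prop :=
  forall J : idealr R, exists d : R,
    forall x, x \in J <-> exists a, x = a * d.

Definition maximal_ideal (R : nzRingType) (M : idealr R) : Prop :=
  forall J : idealr R, {subset M <= J} -> {subset J <= M}.

Definition local_with_maximal_ideal_generated_by (R : comNzRingType) (d : R)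
  : Prop :=
  exists M : idealr R,
    [/\ maximal_ideal M,
        forall J : idealr R, maximal_ideal J -> J =i M
      & forall x, x \in M <-> exists a, x = d * a].

(* The group algebra of a finite group: functions under convolution. The alias *)
(* hides the pointwise product of {ffun gT -> R}.                              *)
Definition galg (R : pzRingType) (gT : finGroupType) := {ffun gT -> R}.

Section GroupAlgebra.
Variables (R : pzRingType) (gT : finGroupType).

HB.instance Definition _ := GRing.Zmodule.copy (galg R gT) {ffun gT -> R}.

Implicit Types a b c : galg R gT.

Definition galg_scale (r : R) a : galg R gT := [ffun g => r * a g].
Definition gelt (g : gT) : galg R gT := [ffun h => (h == g)%:R].
Definition gsum (S : {set gT}) : galg R gT := \sum_(g in S) gelt g.
Definition galg_one : galg R gT := gelt 1%g.
Definition galg_mul a b : galg R gT :=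
  [ffun g => \sum_(h : gT) a h * b (h^-1 * g)%g].

Fact galg_scaleA r s a :
  galg_scale r (galg_scale s a) = galg_scale (r * s) a.
Proof. by apply/ffunP=> g; rewrite !ffunE mulrA. Qed.

Fact galg_scale1 : left_id 1 galg_scale.
Proof. by move=> a; apply/ffunP=> g; rewrite !ffunE mul1r. Qed.

Fact galg_scaleDr : right_distributive galg_scale +%R.
Proof. by move=> r a b; apply/ffunP=> g; rewrite !ffunE mulrDr. Qed.

Fact galg_scaleDl a : {morph galg_scale^~ a : r s / r + s}.
Proof. by move=> r s; apply/ffunP=> g; rewrite !ffunE mulrDl. Qed.

HB.instance Definition _ := GRing.Zmodule_isLmodule.Build R (galg R gT)
  galg_scaleA galg_scale1 galg_scaleDr galg_scaleDl.

Fact galg_mulA : associative galg_mul.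
Proof.
move=> a b c; apply/ffunP=> g; rewrite !ffunE.
under eq_bigr => h _ do rewrite ffunE big_distrr /=.
under [RHS]eq_bigr => h _ do rewrite ffunE big_distrl /=.
rewrite [RHS]exchange_big /=; apply: eq_bigr => h _.
rewrite [RHS](reindex_inj (mulgI h)) /=; apply: eq_bigr => k _.
by rewrite mulKg invMg !mulgA mulrA.
Qed.

Fact galg_mul1 : left_id galg_one galg_mul.
Proof.
move=> a; apply/ffunP=> g; rewrite ffunE (bigD1 1%g) //= ffunE eqxx mul1r.
rewrite invg1 mul1g big1 ?addr0 // => h /negPf h1.
by rewrite ffunE h1 mul0r.
Qed.

Fact galg_mulr1 : right_id galg_one galg_mul.
Proof.
move=> a; apply/ffunP=> g; rewrite ffunE (bigD1 g) //= mulVg ffunE eqxx mulr1.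
rewrite big1 ?addr0 // => h hg; rewrite ffunE.
by rewrite -(inj_eq (mulgI h)) mulKVg mulg1 eq_sym (negPf hg) mulr0.
Qed.

Fact galg_mulDl : left_distributive galg_mul +%R.
Proof.
move=> a b c; apply/ffunP=> g; rewrite !ffunE -big_split.
by apply: eq_bigr => h _; rewrite ffunE mulrDl.
Qed.

Fact galg_mulDr : right_distributive galg_mul +%R.
Proof.
move=> a b c; apply/ffunP=> g; rewrite !ffunE -big_split.
by apply: eq_bigr => h _; rewrite !ffunE mulrDr.
Qed.

HB.instance Definition _ := GRing.Zmodule_isPzRing.Build (galg R gT)
  galg_mulA galg_mul1 galg_mulr1 galg_mulDl galg_mulDr.

Fact galg_scaleAl (r : R) a b : r *: (a * b) = (r *: a) * b.
Proof.
apply/ffunP=> g; rewrite !ffunE big_distrr.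
by apply: eq_bigr => h _ /=; rewrite ffunE mulrA.
Qed.

End GroupAlgebra.

Section CyclicSubmodule.
Variables (A : pzRingType) (V : lmodType A) (x : V).

Definition cyclic_sub : {pred V} := fun y => `[< exists a : A, y = a *: x >].

Lemma cyclic_subP y : reflect (exists a : A, y = a *: x) (y \in cyclic_sub).
Proof. exact: asboolP. Qed.

Fact cyclic_sub_closed : submod_closed cyclic_sub.
Proof.
split=> [|a u v /cyclic_subP[b ->] /cyclic_subP[c ->]]; apply/cyclic_subP.
  by exists 0; rewrite scale0r.
by exists (a * b + c); rewrite scalerDl scalerA.
Qed.

HB.instance Definition _ :=
  GRing.isSubmodClosed.Build A V cyclic_sub cyclic_sub_closed.

Record cyclic_module := CyclicModule {
  cyclic_val : V;
  cyclic_valP : cyclic_val \in cyclic_sub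
}.

HB.instance Definition _ := [isSub for cyclic_val].
HB.instance Definition _ := [Choice of cyclic_module by <:].
HB.instance Definition _ := [SubChoice_isSubLmodule of cyclic_module by <:].

End CyclicSubmodule.

Section ReductionZmod.
Variables (V : zmodType) (l : nat).

Definition multiples : {pred V} := fun x => `[< exists y : V, x = y *+ l >].

Lemma multiplesP x : reflect (exists y, x = y *+ l) (x \in multiples).
Proof. exact: asboolP. Qed.

Fact multiples_closed : zmod_closed multiples.
Proof.
split=> [|u v /multiplesP[b ->] /multiplesP[c ->]]; apply/multiplesP.
  by exists 0; rewrite mul0rn.
by exists (b - c); rewrite mulrnBl.
Qed.

HB.instance Definition _ := GRing.isZmodClosed.Build V multiples multiples_closed.

(* V / lV; for V a ring this is its quotient by the two-sided ideal lV. *)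
Definition reduction := Quotient.quot multiples.

HB.instance Definition _ :=
  GRing.Zmodule.copy reduction (Quotient.quot multiples).

Definition red (x : V) : reduction := \pi_(Quotient.quot multiples) x.
Definition red_repr (x : reduction) : V := generic_quotient.repr x.

Lemma red_reprK : cancel red_repr red.
Proof. exact: reprK. Qed.

Lemma red_eq x y : red x = red y <-> exists z, x = y + z *+ l.
Proof.
split=> [/eqP|[z ->]].
  rewrite -Quotient.idealrBE => /multiplesP[z xy].
  by exists z; rewrite -xy addrC subrK.
by apply/eqP; rewrite -Quotient.idealrBE; apply/multiplesP; exists z; rewrite addrC addKr.
Qed.

Lemma redD : {morph red : x y / x + y}.
Proof. by move=> x y; rewrite /red raddfD. Qed.

Lemma red_repr_red x : exists z, red_repr (red x) = x + z *+ l.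
Proof. by apply/red_eq; rewrite red_reprK. Qed.

End ReductionZmod.

Section ReductionRing.
Variables (R : comPzRingType) (l : nat).
Local Notation K := (reduction R l).
Implicit Types x y z : K.

Definition red_one : K := red l 1.
Definition red_mul x y : K := red l (red_repr x * red_repr y).

Lemma red_mulE a b : red_mul (red l a) (red l b) = red l (a * b).
Proof.
apply/red_eq; have [u ->] := red_repr_red l a; have [v ->] := red_repr_red l b.
exists (a * v + u * b + u * v *+ l).
by rewrite mulrDl !mulrDr !mulrnDl !mulrnAr !mulrnAl !addrA.
Qed.

Fact red_mulA : associative red_mul.
Proof.
move=> x y z; rewrite -[x]red_reprK -[y]red_reprK -[z]red_reprK.
by rewrite !red_mulE mulrA.
Qed.

Fact red_mulC : commutative red_mul.
Proof. by move=> x y; rewrite /red_mul mulrC. Qed.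

Fact red_mul1 : left_id red_one red_mul.
Proof. by move=> x; rewrite -[x]red_reprK red_mulE mul1r. Qed.

Fact red_mulDl : left_distributive red_mul +%R.
Proof.
move=> x y z; rewrite -[x]red_reprK -[y]red_reprK -[z]red_reprK.
by rewrite -redD !red_mulE -redD mulrDl.
Qed.

HB.instance Definition _ := GRing.Zmodule_isComPzRing.Build K
  red_mulA red_mulC red_mul1 red_mulDl.

End ReductionRing.

(* If V is an RG-module then V / lV is an (R / lR)G-module: act through        *)
(* representatives; by red_scaleE the choice of these does not matter.         *)
Section ReductionModule.
Variables (R : comPzRingType) (gT : finGroupType) (l : nat).
Local Notation RG := (galg R gT).
Local Notation KG := (galg (reduction R l) gT).
Variable V : lmodType RG.
Local Notation L := (reduction V l).

Definition galg_red (a : RG) : KG := [ffun g => red l (a g)].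
Definition galg_repr (a : KG) : RG := [ffun g => red_repr (a g)].

Lemma galg_reprK : cancel galg_repr galg_red.
Proof. by move=> a; apply/ffunP=> g; rewrite !ffunE red_reprK. Qed.

Definition red_scale (a : KG) (v : L) : L := red l (galg_repr a *: red_repr v).

Lemma galg_repr_red a : exists b : RG, galg_repr (galg_red a) = a + b *+ l.
Proof.
have /fin_all_exists[b bP] g : exists z, red_repr (red l (a g)) = a g + z *+ l.
  exact: red_repr_red.
exists [ffun g => b g]; apply/ffunP=> g.
by rewrite !ffunE bP ffunMnE ffunE.
Qed.

Lemma red_scaleE (a : RG) (v : V) :
  red_scale (galg_red a) (red l v) = red l (a *: v).
Proof.
apply/red_eq; have [b ->] := galg_repr_red a; have [w ->] := red_repr_red l v.
exists (a *: w + b *: v + (b *: w) *+ l).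
have scaleMn (c : RG) (u : V) : (c *+ l) *: u = (c *: u) *+ l.
  by rewrite -scalerMnl.
rewrite scalerDl !scalerDr !scaleMn -!scalerMnr !mulrnDl.
by rewrite !addrA.
Qed.

Fact galg_redM : {morph galg_red : a b / a * b}.
Proof.
have redM (x y : R) : red l (x * y) = red l x * red l y :> reduction R l.
  exact/esym/red_mulE.
have red0 : red l 0 = 0 :> reduction R l by exact: raddf0.
move=> a b; apply/ffunP=> g; rewrite !ffunE.
rewrite (big_morph _ (@redD R l) red0).
by apply: eq_bigr => h _; rewrite redM !ffunE.
Qed.

Fact galg_redD : {morph galg_red : a b / a + b}.
Proof. by move=> a b; apply/ffunP=> g; rewrite !ffunE redD. Qed.

Fact galg_red1 : galg_red 1 = 1.
Proof.
apply/ffunP=> g; rewrite !ffunE; case: eqP => _ //.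
exact: raddf0.
Qed.

Fact red_scaleA a b v : red_scale a (red_scale b v) = red_scale (a * b) v.
Proof.
rewrite -[a]galg_reprK -[b]galg_reprK -[v]red_reprK.
by rewrite -galg_redM !red_scaleE scalerA.
Qed.

Fact red_scale1 : left_id 1 red_scale.
Proof. by move=> v; rewrite -[v]red_reprK -galg_red1 red_scaleE scale1r. Qed.

Fact red_scaleDr : right_distributive red_scale +%R.
Proof.
move=> a u v; rewrite -[a]galg_reprK -[u]red_reprK -[v]red_reprK.
by rewrite -redD !red_scaleE -redD scalerDr.
Qed.

Fact red_scaleDl v : {morph red_scale^~ v : a b / a + b}.
Proof.
move=> a b; rewrite -[a]galg_reprK -[b]galg_reprK -[v]red_reprK.
by rewrite -galg_redD !red_scaleE -redD scalerDl.
Qed.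

HB.instance Definition _ := GRing.Zmodule_isLmodule.Build KG L
  red_scaleA red_scale1 red_scaleDr red_scaleDl.

End ReductionModule.

Section GeneralLinear.
Variables (F : finFieldType) (n : nat).
Local Notation G := {'GL_n[F]}.

Definition borel : {set G} :=
  [set g : G | [forall i : 'I_n.-1.+1, forall j : 'I_n.-1.+1,
    (j < i)%N ==> (GLval g i j == 0)]].

Definition unitriangular : {set G} :=
  [set g in borel | [forall i, GLval g i i == 1]].

(* The entry (i, j) of perm_mx s is (s i == j). The opposite convention, which *)
(* replaces s by s^-1, yields the same steinberg_elt and the same parabolic.   *)
Definition permGL (s : 'S_n.-1.+1) : G :=
  FinRing.Unit (unitmx_perm F s : perm_mx s \is a GRing.unit).

(* Root subgroup X_{i,j}, meant for i != j. *)
Definition root_subgroup (i j : 'I_n.-1.+1) : {set G} :=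
  [set g : G | [exists a : F, GLval g == 1%:M + a *: delta_mx i j]].

Section Steinberg.
Variable R : idomainType.
Local Notation RG := (galg R {'GL_n[F]}).

(* RG^o is RG as a left module over itself. *)
Definition steinberg_elt : RG^o :=
  \sum_(s : 'S_n.-1.+1) (-1) ^+ s *: (gelt R (permGL s) * gsum R borel).

Definition steinberg_lattice := cyclic_module steinberg_elt.

HB.instance Definition _ := GRing.Lmodule.on steinberg_lattice.

(* A homomorphism U -> R^*; the values of lam outside U are irrelevant. *)
Definition linear_character (lam : G -> R) : Prop :=
  {in unitriangular, forall u, lam u \is a GRing.unit} /\
  {in unitriangular &, {morph lam : u v / (u * v)%g >-> u * v}}.

Definition nontrivial_on (lam : G -> R) (S : {set G}) : bool :=
  [exists u in S, lam u != 1].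

Definition parabolic (lam : G -> R) : {set G} :=
  <<borel :|: [set g : G | [exists i : 'I_n.-1.+1, exists j : 'I_n.-1.+1,
     [&& j == i.+1 :> nat, nontrivial_on lam (root_subgroup i j)
       & g == permGL (tperm i j)]]]>>%g.

Definition E_lambda (lam : G -> R) : RG^o :=
  \sum_(u in unitriangular) lam u *: (gelt R u * steinberg_elt).

Fact E_lambda_in_lattice lam : E_lambda lam \in cyclic_sub steinberg_elt.
Proof.
apply/cyclic_subP; exists (\sum_(u in unitriangular) lam u *: gelt R u).
rewrite /E_lambda scaler_suml; apply: eq_bigr => u _.
exact: galg_scaleAl.
Qed.

Definition E_lambda_lattice (lam : G -> R) : steinberg_lattice :=
  CyclicModule (E_lambda_in_lattice lam).

Definition F_lambda (l : nat) (lam : G -> R) : reduction steinberg_lattice l :=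
  red l (E_lambda_lattice lam).

End Steinberg.
End GeneralLinear.

(* Main.v *)
Require Import Defs.
From HB Require Import structures.
From mathcomp Require Import all_boot all_order all_algebra all_fingroup.
From mathcomp Require Import cyclic pgroup finfield ring_quotient boolp.
From mathcomp Require classical_sets.
From mathcomp Require Import zify ring.

Set Implicit Arguments.
Unset Strict Implicit.
Unset Printing Implicit Defensive.

Import GRing.Theory.
Local Open Scope ring_scope.

(** Write s(mu) for the sum of mu(u) u over u in U, and E(mu) = s(mu) eps, for
    any linear character mu of U, however degenerate; eps is the Steinberg
    element, I the lattice that it generates and N = RG E(lam).  The point is
    that eps lies in N; the statement on L then follows by reducing an identity
    eps = b E(lam) modulo l.

    In the rank one group of a simple root, s x(a) eps = x(1/a) eps - eps for
    a <> 0 (rank_one_relation).  Hence the translates of eps by U span I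
    (steinberg_span), I is a quotient of the regular module of U, and s(mu)
    maps I into R E(mu) (eigenspace_span).  Two arguments remain.

    1. N contains enough E(mu) (simple_character_degenerate).  Since lam is a
    character of U that is non-trivial on all simple roots, conjugation by the
    torus turns it into chi(sum of the superdiagonal entries) for one additive
    character chi of F, and it is enough to treat the mu obtained from it by
    keeping only a set J of simple roots.  If w_J and w_0 are the reversal of
    the blocks cut out by J and the reversal of everything, then
    s(mu) w_J w_0 E(lam) = c E(mu) for some c in R, and c is found by reading
    elements of RG as functions on G and evaluating both sides at the
    permutation matrix of w_J.  There E(mu) takes the value + or - |Q|, where
    Q is the subgroup of the u in U that w_J conjugates into B; on the left the
    equivariance of E(lam) under U and B makes each of the |U| terms equal to
    the sign of w_0, so that no exponential sum has to be computed.  Thus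
    c |Q| = + or - |U|, a power of p, and p is a unit of R because R is local
    with residue characteristic l <> p.

    2. The linear characters of U detect everything (fourier_descent).  Let
    U_k be the subgroup of the matrices in U that are trivial in the columns
    before k, and s_k(mu) the analogue of s(mu) for U_k.  Then s_k(mu) g eps
    lies in N for all g in G and all these mu: for k = 0 this is the first
    argument.  Going from k to k + 1, Fourier inversion writes a multiple of
    s_(k+1)(mu) by a power of |F| as a sum over all characters of the column k,
    and GL_k, which does not move the rest of mu, conjugates every non-trivial
    one to the character that only sees the entry of the simple root.  So all
    terms are conjugate to some s_k(mu').  At the last step U_k is trivial, and
    g = 1 gives eps in N. *)

(** * Units of a local ring *)

(** The proof argument lets the ideal structure be attached to S. *)
Definition ideal_of_closed (R : nzRingType) (S : R -> bool)
  of idealr_closed S : R -> bool := S.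

HB.instance Definition _ (R : nzRingType) (S : R -> bool)
    (S_ideal : idealr_closed S) :=
  isIdealr.Build R (ideal_of_closed S_ideal) S_ideal.

(** Zorn's lemma is applied to predicates on R rather than to bundled ideals,
    which live in too large a universe. *)
Lemma sub_maximal_ideal (R : nzRingType) (J : R -> bool) :
    idealr_closed J ->
  exists2 M : idealr R, {subset J <= M} & maximal_ideal M.
Proof.
move=> J_ideal.
pose T := {S : R -> bool | idealr_closed S /\ {subset J <= S}}.
pose leT (M N : T) := `[< {subset sval M <= sval N} >].
have [[S [S_ideal sJS]] Smax] : exists M : T, classical_sets.premaximal leT M.
  pose J0 : T := exist _ J (conj J_ideal (fun _ Jx => Jx)).
  apply: (@classical_sets.ZL_preorder T J0 leT)
    => [M|L M N /asboolP sLM /asboolP sMN|A totA].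
  - exact/asboolP.
  - by apply/asboolP=> x /sLM/sMN.
  have [A0|/existsNP[M0 /contrapT AM0]] := pselect (forall M, ~ A M).
    by exists J0 => M /A0.
  pose S x : bool := `[< exists2 M, A M & x \in sval M >].
  have S_ideal : idealr_closed S.
    split=> [||a x y /asboolP[M AM Mx] /asboolP[N AN Ny]].
    - by apply/asboolP; exists M0 => //; have [[]] := svalP M0.
    - by apply/negP=> /asboolP[M _]; have [[_ /negP]] := svalP M.
    have [[_ _ linM] _] := svalP M; have [[_ _ linN] _] := svalP N.
    apply/asboolP; have [/asboolP sMN|/asboolP sNM] := totA M N AM AN.
      by exists N => //; apply: linN => //; apply: sMN.
    by exists M => //; apply: linM => //; apply: sNM.
  have sAS M : A M -> {subset sval M <= S}.
    by move=> AM x Mx; apply/asboolP; exists M.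
  have sJS : {subset J <= S}.
    by have [_ sJM] := svalP M0; move=> x /sJM; apply: sAS.
  by exists (exist _ S (conj S_ideal sJS)) => M AM; apply/asboolP/sAS.
exists (ideal_of_closed S_ideal : idealr R) => // N sSN.
have N_ideal : idealr_closed N.
  by split=> [||a x y Nx Ny]; rewrite ?idealr0 ?idealr1 ?rpredD ?idealMr.
have sJN : {subset J <= N} by move=> x /sJS/sSN.
have /asboolP := Smax (exist _ _ (conj N_ideal sJN)) (asboolT sSN).
exact.
Qed.

(** The ideal generated by a non-unit is proper, so it lies in a maximal ideal,
    and there is only one. *)
Lemma local_nonunit (R : comUnitRingType) (d x : R) :
    local_with_maximal_ideal_generated_by d ->
  x \isn't a GRing.unit -> exists a, x = d * a.
Proof.
case=> M [Mmax Muniq ME] xN1; apply/ME.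
pose S y : bool := `[< exists a, y = a * x >].
have S_ideal : idealr_closed S.
  split=> [||a _ _ /asboolP[b ->] /asboolP[c ->]]; apply/asboolP.
  - by exists 0; rewrite mul0r.
  - by case=> a; rewrite mulrC => /esym ax1; case/unitrPr: xN1; exists a.
  by exists (a * b + c); rewrite mulrDl mulrA.
have [N sSN Nmax] := sub_maximal_ideal S_ideal.
rewrite -(Muniq N Nmax) sSN //; apply/asboolP.
by exists 1; rewrite mul1r.
Qed.

(** By Bezout, m is invertible modulo l, hence outside the maximal ideal. *)
Lemma local_natr_unit (R : comUnitRingType) (l m : nat) :
    local_with_maximal_ideal_generated_by (l%:R : R) -> (0 < m)%N ->
  coprime m l -> (m%:R : R) \is a GRing.unit.
Proof.
move=> localR m_gt0 /(coprimeP _ m_gt0)[[u v] /= uv].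
apply: contraT => /(local_nonunit localR)[a ma].
have [M [_ _ ME]] := localR.
suff /ME : exists b, 1 = l%:R * b :> R by rewrite idealr1.
exists (u%:R * a - v%:R).
have u1 : 1 = u%:R * m%:R - v%:R * l%:R :> R.
  by rewrite -!natrM -natrB ?uv // ltnW // -subn_gt0 uv.
by rewrite [LHS]u1 ma mulrBr mulrCA [v%:R * _]mulrC.
Qed.

Lemma card_finField_unit (F : finFieldType) (p : nat) (R : comUnitRingType) :
    p \in [pchar F] -> (p%:R : R) \is a GRing.unit ->
  (#|F|%:R : R) \is a GRing.unit.
Proof.
move=> charF pU; have := card_pgroup (pprimeChar_pgroup charF).
by rewrite cardsT => ->; rewrite natrX unitrX.
Qed.

(** * Weighted sums in a group algebra *)

Lemma mulg_sandwichV (gT : groupType) (x y : gT) :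
  (x * y^-1 * x^-1 = (x * y * x^-1)^-1)%g.
Proof. by rewrite !invMg invgK mulgA. Qed.

Lemma mulg_twist (gT : groupType) (x y d v : gT) :
  (x * (y * (d * v) * y^-1) = (x * y) * d * (x * y)^-1 * (x * (y * v * y^-1)))%g.
Proof. by rewrite invMg !mulgA !mulgKV. Qed.

Section GroupAlgebraFacts.
Variables (R : comPzRingType) (gT : finGroupType).
Local Notation RG := (galg R gT).
Implicit Types (a b x : RG) (g h : gT) (f : gT -> R) (S : {set gT}).

Lemma geltM g h : gelt R (g * h)%g = gelt R g * gelt R h :> RG.
Proof.
apply/ffunP=> k; rewrite !ffunE (bigD1 g) //= !ffunE eqxx mul1r.
rewrite -(inj_eq (mulgI g^-1%g)) mulKg big1 ?addr0 // => m /negPf mg.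
by rewrite ffunE mg mul0r.
Qed.

Lemma gelt1_mul x : gelt R 1%g * x = x. Proof. exact: mul1r. Qed.

Lemma gelt_mulA g h x : gelt R g * (gelt R h * x) = gelt R (g * h)%g * x.
Proof. by rewrite geltM mulrA. Qed.

Lemma gelt_conj_absorb g h x : gelt R (h^-1 * g * h)%g * x = x ->
  gelt R g * (gelt R h * x) = gelt R h * x.
Proof.
by move=> gx; rewrite -[in RHS]gx !gelt_mulA !mulgA mulgV mul1g.
Qed.

(** The relations of the rank one group, read in a module where H is fixed by
    its Borel subgroup. *)
Lemma rank_one_module_relation (s x y b : gT) (H : RG) :
    (s * s = 1)%g -> (s * x * s = y * s * b)%g ->
    gelt R x * H = H -> gelt R y * H = H -> gelt R b * H = H ->
  gelt R s * (gelt R x * (H - gelt R s * H)) =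
  gelt R y * (H - gelt R s * H) - (H - gelt R s * H).
Proof.
move=> ss sxs xH yH bH; rewrite !mulrBr xH yH !gelt_mulA sxs.
rewrite -[gelt R (y * s * b)%g * H]gelt_mulA bH.
by rewrite opprB addrCA addrAC subrr add0r.
Qed.

Lemma gelt_involution_twist (s u w : gT) x : (s * s = 1)%g ->
  gelt R s * (gelt R u * x) =
  gelt R (s * (u * w^-1) * s)%g * (gelt R s * (gelt R w * x)).
Proof.
move=> ss; rewrite !gelt_mulA; congr (gelt R _ * _).
by rewrite -(mulgA _ s s) ss mulg1 mulgA mulgKV.
Qed.

Lemma gelt_mulE g x h : (gelt R g * x) h = x (g^-1 * h)%g.
Proof.
rewrite ffunE (bigD1 g) //= !ffunE eqxx mul1r big1 ?addr0 // => m /negPf mg.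
by rewrite ffunE mg mul0r.
Qed.

Lemma galg_scaleAr (r : R) a b : r *: (a * b) = a * (r *: b).
Proof.
apply/ffunP=> g; rewrite !ffunE big_distrr.
by apply: eq_bigr => h _ /=; rewrite ffunE mulrCA.
Qed.

Lemma galg_sumE I (r : seq I) (P : pred I) (G : I -> RG) g :
  (\sum_(i <- r | P i) G i) g = \sum_(i <- r | P i) G i g.
Proof.
by elim/big_rec2: _ => [|i x y _ <-]; rewrite !ffunE.
Qed.

Lemma gsumE S g : gsum R S g = (g \in S)%:R.
Proof.
rewrite galg_sumE; have [Sg|nSg] := boolP (g \in S).
  rewrite (bigD1 g) //= ffunE eqxx big1 ?addr0 // => h /andP[_ /negPf hg].
  by rewrite ffunE eq_sym hg.
rewrite big1 // => h Sh; rewrite ffunE; case: eqP => // gh.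
by rewrite gh Sh in nSg.
Qed.

Definition weighted_sum S f : RG := \sum_(u in S) f u *: gelt R u.

Lemma weighted_sumMl S f x :
  weighted_sum S f * x = \sum_(u in S) f u *: (gelt R u * x).
Proof.
by rewrite big_distrl /=; apply: eq_bigr => u _; rewrite -galg_scaleAl.
Qed.

Lemma weighted_sum_mulE S f x g :
  (weighted_sum S f * x) g = \sum_(u in S) f u * x (u^-1 * g)%g.
Proof.
rewrite weighted_sumMl galg_sumE; apply: eq_bigr => u _.
by rewrite ffunE gelt_mulE.
Qed.

Lemma galg_weighted_sum a : a = weighted_sum [set: gT] a.
Proof.
apply/ffunP=> g; rewrite galg_sumE (bigD1 g) ?inE //= !ffunE eqxx mulr1.
rewrite big1 ?addr0 // => h /andP[_ /negPf hg].
by rewrite !ffunE eq_sym hg mulr0.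
Qed.

Lemma scalar_action_ext a b y :
    (forall g, exists c : R, a * (gelt R g * b) = c *: y) ->
  forall x, exists c : R, a * (x * b) = c *: y.
Proof.
move=> /boolp.choice[c cE] x; exists (\sum_(g in [set: gT]) x g * c g).
rewrite {1}[x]galg_weighted_sum weighted_sumMl big_distrr scaler_suml.
by apply: eq_bigr => g _ /=; rewrite -galg_scaleAr cE scalerA.
Qed.

Lemma weighted_sum_conj S f g : {in S, forall u, (u ^ g)%g \in S} ->
  weighted_sum S (fun u => f (u ^ g)%g) =
  gelt R g * weighted_sum S f * gelt R g^-1%g.
Proof.
move=> Sg; have Sgi u : ((u ^ g)%g \in S) = (u \in S).
  have /eqP SgS : (S :^ g)%g == S.
    rewrite eqEcard cardJg leqnn andbT; apply/subsetP=> _ /imsetP[v Sv ->].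
    exact: Sg.
  by rewrite -{1}SgS memJ_conjg.
rewrite [in RHS]/weighted_sum big_distrr big_distrl /=.
rewrite [RHS](reindex_inj (conjg_inj g)).
apply: eq_big => u; first by rewrite Sgi.
move=> _; rewrite -galg_scaleAr -galg_scaleAl -!geltM conjgE.
by rewrite !mulgA mulgK mulgV mul1g.
Qed.

Lemma weighted_sum_mul_eigen (H : {group gT}) f x u g :
    {in H &, {morph f : v w / (v * w)%g >-> v * w}} -> u \in H ->
  (weighted_sum H f * x) (u * g)%g = f u * (weighted_sum H f * x) g.
Proof.
move=> fM uH; rewrite !weighted_sum_mulE big_distrr /=.
rewrite (reindex_inj (mulgI u)); apply: eq_big => [v|v]; first by rewrite groupMl.
rewrite groupMl // => vH; rewrite fM // mulrA; congr (_ * x _).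
by rewrite invMg -mulgA mulKg.
Qed.

Lemma weighted_sum_mulr_eigen (H : {group gT}) f v :
    {in H &, {morph f : u w / (u * w)%g >-> u * w}} -> v \in H ->
  weighted_sum H f * gelt R v = f (v^-1)%g *: weighted_sum H f.
Proof.
move=> fM vH; rewrite scaler_sumr weighted_sumMl (reindex_inj (mulIg v^-1%g)) /=.
apply: eq_big => [u|u]; first by rewrite groupMr ?groupV.
rewrite groupMr ?groupV // => uH.
by rewrite -geltM mulgKV fM ?groupV // scalerA mulrC.
Qed.

End GroupAlgebraFacts.

Lemma cyclic_subM (R : comPzRingType) (gT : finGroupType)
    (x : (galg R gT)^o) (a y : galg R gT) :
  y \in cyclic_sub x -> a * y \in cyclic_sub x.
Proof. by move/(rpredZ a). Qed.

Lemma cyclic_sub_scale (R : comPzRingType) (gT : finGroupType)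
    (x : (galg R gT)^o) (r : R) (y : galg R gT) :
  y \in cyclic_sub x -> r *: y \in cyclic_sub x.
Proof.
have -> : r *: y = (r *: gelt R 1%g : galg R gT) * y :> galg R gT
  by rewrite -galg_scaleAl mul1r.
exact: cyclic_subM.
Qed.

(** * Additive characters of a finite field *)

Section AdditiveCharacters.
Variables (F : finFieldType) (R : idomainType).
Implicit Types (a b c t : F) (chi psi : F -> R).

Definition additive_character chi : Prop :=
  chi 0 = 1 /\ {morph chi : a b / a + b >-> a * b}.

Lemma additive_character_sum chi :
    additive_character chi -> (exists a, chi a != 1) ->
  \sum_a chi a = 0.
Proof.
move=> [_ chiD] [a chia]; set S := \sum_a _.
have /eqP : (chi a - 1) * S = 0.
  rewrite mulrBl mul1r {1}/S big_distrr /=; apply/eqP; rewrite subr_eq0.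
  rewrite /S [X in _ == X](reindex_inj (addrI a)).
  by under [X in _ == X]eq_bigr do rewrite chiD.
by rewrite mulf_eq0 subr_eq0 (negPf chia) => /eqP.
Qed.

Lemma additive_character_mull chi t :
  additive_character chi -> additive_character (fun a => chi (t * a)).
Proof.
by move=> [chi0 chiD]; split=> [|a b]; rewrite ?mulr0 // mulrDr chiD.
Qed.

Lemma additive_character_dual_sum chi w :
    additive_character chi -> (exists a, chi a != 1) ->
  \sum_t chi (t * w) = #|F|%:R * (w == 0)%:R.
Proof.
move=> chi_char [a chia]; have [->|w0] := eqVneq w 0.
  under eq_bigr do rewrite mulr0 chi_char.1.
  by rewrite sumr_const mulr1.
rewrite mulr0; under eq_bigr do rewrite mulrC.
apply: additive_character_sum; first exact: additive_character_mull.
by exists (w^-1 * a); rewrite mulVKf.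
Qed.

(** Fourier inversion at the origin of a coordinate space. *)
Lemma additive_character_orthogonality chi (I : finType) (w : I -> F) :
    additive_character chi -> (exists a, chi a != 1) ->
  \sum_(c : {ffun I -> F}) chi (\sum_i c i * w i) =
  (#|F|%:R ^+ #|I|) * ([forall i, w i == 0])%:R.
Proof.
move=> chi_char chi_nt; have [chi0 chiD] := chi_char.
under eq_bigr do rewrite (big_morph chi chiD chi0).
rewrite -(bigA_distr_bigA (fun i t => chi (t * w i))).
under eq_bigr do rewrite additive_character_dual_sum //.
rewrite big_split /= prodr_const; congr (_ * _).
have [/forallP w0|] := boolP [forall i, w i == 0].
  by rewrite big1 // => i _; rewrite w0.
rewrite negb_forall => /existsP[i /negPf wi].
by rewrite (bigD1 i) //= wi mul0r.
Qed.

(** A character different from all multiples of chi would be orthogonal to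
    them, hence to the indicator function of 0, a combination of them. *)
Lemma additive_character_multiple chi psi :
    additive_character chi -> (exists a, chi a != 1) ->
    additive_character psi -> (exists a, psi a != 1) ->
    (#|F|%:R != 0 :> R) ->
  exists2 t, t != 0 & forall a, psi a = chi (t * a).
Proof.
move=> chi_char chi_nt psi_char [a0 psia0] q0.
have [chi0 chiD] := chi_char; have [psi0 psiD] := psi_char.
case: (boolP [exists t, [forall a, psi a * chi (t * - a) == 1]]).
  move=> /existsP[t /forallP psit]; have psiE a : psi a = chi (t * a).
    rewrite -[LHS]mulr1 -chi0 -(mulr0 t) -(addNr a) mulrDr chiD mulrA.
    by rewrite (eqP (psit a)) mul1r.
  by exists t => //; apply: contraNneq psia0 => t0; rewrite psiE t0 mul0r chi0.
rewrite negb_exists => /forallP no_t; case/eqP: q0.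
transitivity (\sum_t \sum_a psi a * chi (t * - a)).
  rewrite exchange_big /= (bigD1 0) //= -big_distrr /= psi0 mul1r.
  rewrite additive_character_dual_sum // oppr0 eqxx mulr1 big1 ?addr0 //.
  move=> a /negPf a_neq0; rewrite -big_distrr additive_character_dual_sum //=.
  by rewrite oppr_eq0 a_neq0 !mulr0.
apply: big1 => t _; apply: additive_character_sum.
  split=> [|a b]; first by rewrite oppr0 mulr0 chi0 psi0 mulr1.
  by rewrite opprD mulrDr psiD chiD mulrACA.
by have:= no_t t; rewrite negb_forall => /existsP.
Qed.

End AdditiveCharacters.

(** * Reversal inside blocks *)

Section BlockReversal.
Variables (n : nat) (J : pred 'I_n.+1).
Local Notation I := 'I_n.+1.
Implicit Types (i j k l m : I).

(** The blocks are the intervals obtained by cutting before each index m > 0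
    outside J; they are numbered from 0. *)
Definition block i : nat := #|[set m : I | (0 < m <= i)%N & ~~ J m]|.

Lemma block_mono i j : (i <= j)%N -> (block i <= block j)%N.
Proof.
move=> ij; apply/subset_leq_card/subsetP=> m; rewrite !inE.
by case/andP=> /andP[-> mi] ->; rewrite (leq_trans mi).
Qed.

Lemma block_succ i j : j = i.+1 :> nat -> (block i == block j) = J j.
Proof.
move=> ji; have [Jj|nJj] := boolP (J j).
  apply/eqP/eq_card=> m; rewrite !inE; case: (eqVneq m j) => [->|].
    by rewrite Jj !andbF.
  by rewrite -val_eqE /= => mj; congr (_ && _); lia.
apply/negbTE; rewrite neq_ltn; apply/orP; left; apply: proper_card.
apply/properP; split.
  apply/subsetP=> m; rewrite !inE => /andP[mi ->]; lia.
by exists j; rewrite !inE ?nJj; lia.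
Qed.

(** The total order that keeps the blocks in place and reverses each of them. *)
Definition block_prec k i :=
  (block k < block i)%N || (block k == block i) && (i < k)%N.

Lemma block_rank_subproof i : (#|[set k | block_prec k i]| < n.+1)%N.
Proof.
rewrite -[X in (_ < X)%N]card_ord -cardsT; apply: proper_card.
apply/properP; split; first exact: subsetT.
by exists i; rewrite !inE /block_prec ?ltnn ?andbF.
Qed.

Definition block_rank i : I := Ordinal (block_rank_subproof i).

Lemma block_rank_lt k i : block_prec k i -> (block_rank k < block_rank i)%N.
Proof.
move=> ki; apply: proper_card; apply/properP; split; last first.
  by exists k; rewrite !inE // /block_prec !ltnn andbF.
apply/subsetP=> m; rewrite !inE; move: ki; rewrite /block_prec; lia.
Qed.

Lemma block_rank_inj : injective block_rank.
Proof.
move=> i j ij; apply/eqP; apply: contraT => ne_ij.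
have [|] : block_prec i j \/ block_prec j i.
  by move: ne_ij; rewrite -val_eqE /= /block_prec; lia.
all: by move/block_rank_lt; rewrite ij ltnn.
Qed.

(** The longest element of the Young subgroup attached to J. *)
Definition block_reversal : {perm I} := perm block_rank_inj.

Lemma block_reversal_across i j :
  (block i < block j)%N -> (block_reversal i < block_reversal j)%N.
Proof. by move=> ij; rewrite !permE block_rank_lt // /block_prec ij. Qed.

Lemma block_reversal_inside i j : (i < j)%N -> block i = block j ->
  (block_reversal j < block_reversal i)%N.
Proof.
by move=> ij bij; rewrite !permE block_rank_lt // /block_prec bij eqxx ij orbT.
Qed.

Lemma block_reversal_adjacent i j : (i < j)%N -> block i = block j ->
  (block_reversal i == (block_reversal j).+1 :> nat) = (j == i.+1 :> nat).
Proof.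
have succ k l : l = k.+1 :> nat -> block k = block l ->
    block_reversal k = (block_reversal l).+1 :> nat.
  move=> lk bkl; rewrite !permE /=.
  rewrite (cardsD1 l) !inE {1}/block_prec bkl eqxx lk ltnSn orbT.
  congr _.+1; apply: eq_card => m; rewrite !inE /block_prec bkl.
  case: eqVneq => [->|]; first by rewrite !ltnn andbF.
  move=> ml; have {}ml : m != k.+1 :> nat by rewrite -lk.
  by rewrite andTb lk; congr (_ || (_ && _)); lia.
move=> ij bij; have [ji|ne_ji] := eqVneq (j : nat) i.+1.
  by rewrite (succ i j) ?eqxx.
apply/negbTE; apply: contraNneq ne_ji => rij.
have lt_ij : (i.+1 < n.+1)%N by apply: leq_ltn_trans ij (ltn_ord j).
pose m : I := Ordinal lt_ij.
have bim : block i = block m.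
  apply/eqP; rewrite eqn_leq block_mono //= bij block_mono //.
suff <- : m = j by [].
apply/(@perm_inj _ block_reversal)/val_inj/succn_inj; rewrite /= -rij.
by rewrite -(succ i m).
Qed.

End BlockReversal.

(** * Upper triangular matrices, root elements and the torus *)

Section GroupMatrices.
Variables (F : finFieldType) (n : nat).
Local Notation gT := [the finGroupType of {'GL_n[F]}].
Local Notation G := (FinGroup.sort gT).
Local Notation I := 'I_n.-1.+1.
Local Notation B := (borel F n).
Local Notation U := (unitriangular F n).
Implicit Types (g h u v : G) (A : 'M[F]_n.-1.+1) (i j k : I) (s t : 'S_n.-1.+1).

Lemma GL_entryM g h i j : GLval (g * h)%g i j = \sum_k GLval g i k * GLval h k j.
Proof. by rewrite GL_MxE mxE. Qed.

Lemma GL_eqP g h : (forall i j, GLval g i j = GLval h i j) -> g = h.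
Proof. by move=> gh; apply/val_inj/matrixP. Qed.

Lemma GL_one i j : GLval (1%g : G) i j = (i == j)%:R.
Proof. by rewrite GL_1E mxE. Qed.

(** The element 1 stands in for a singular matrix. *)
Definition to_GL A : G := insubd (1%g : {'GL_n[F]}) A.

Lemma to_GL_K A : A \in unitmx -> GLval (to_GL A) = A.
Proof.
move=> AU; rewrite -[GLval _]/(val _) val_insubd.
by rewrite -[_ \is a _]/(A \in unitmx) AU.
Qed.

Lemma borelP g : reflect (forall i j, (j < i)%N -> GLval g i j = 0) (g \in B).
Proof.
rewrite inE; apply: (iffP forallP) => [gB i j ji|gB i].
  by move/(_ i)/forallP/(_ j): gB; rewrite ji => /eqP.
by apply/forallP=> j; apply/implyP=> ji; rewrite gB.
Qed.

Lemma unitriangularP u :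
  reflect ((forall i j, (j < i)%N -> GLval u i j = 0) /\
           (forall i, GLval u i i = 1)) (u \in U).
Proof.
rewrite inE; apply: (iffP andP) => -[uB u1].
  by split=> [|i]; [apply/borelP | apply/eqP/(forallP u1)].
by split; [apply/borelP | apply/forallP=> i; rewrite u1].
Qed.

Lemma borel_diagM g h i : g \in B -> h \in B ->
  GLval (g * h)%g i i = GLval g i i * GLval h i i.
Proof.
move=> /borelP gB /borelP hB; rewrite GL_entryM (bigD1 i) //= big1 ?addr0 //.
move=> k ki; have [lt_ki|lt_ik|/val_inj eq_ki] := ltngtP k i.
- by rewrite gB ?mul0r.
- by rewrite hB ?mulr0.
- by rewrite eq_ki eqxx in ki.
Qed.

Lemma borel_group_set : group_set B.
Proof.
apply/group_setP; split=> [|g h /borelP gB /borelP hB]; apply/borelP=> i j ji.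
  by rewrite GL_one; case: eqP ji => // ->; rewrite ltnn.
rewrite GL_entryM big1 // => k _; have [lt_ki|le_ik] := ltnP k i.
  by rewrite gB ?mul0r.
by rewrite hB ?mulr0 // (leq_trans ji).
Qed.
Canonical borel_group := Group borel_group_set.

Lemma unitriangular_group_set : group_set U.
Proof.
apply/group_setP; split=> [|g h].
  by rewrite inE (group1 borel_group); apply/forallP=> i; rewrite GL_one eqxx.
rewrite inE => /andP[gB /forallP g1]; rewrite inE => /andP[hB /forallP h1].
rewrite inE groupM //; apply/forallP=> i.
by rewrite borel_diagM // (eqP (g1 i)) (eqP (h1 i)) mulr1.
Qed.
Canonical unitriangular_group := Group unitriangular_group_set.

Lemma borelM g h : g \in B -> h \in B -> (g * h)%g \in B.
Proof. exact: (@groupM _ borel_group). Qed.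

Lemma unitriangularM u v : u \in U -> v \in U -> (u * v)%g \in U.
Proof. exact: (@groupM _ unitriangular_group). Qed.

Lemma unitriangularV u : u \in U -> (u^-1)%g \in U.
Proof. exact: (@groupVr _ unitriangular_group). Qed.

Lemma unitriangular_sub_borel : U \subset B.
Proof. by apply/subsetP=> u; rewrite inE => /andP[]. Qed.

Lemma triangular_unitmx A : (forall i j, (j < i)%N -> A i j = 0) ->
  (forall i, A i i != 0) -> A \in unitmx.
Proof.
move=> A0 A1; rewrite unitmxE -det_tr det_trig.
  by rewrite unitfE; apply/prodf_neq0=> i _; rewrite mxE.
by apply/is_trig_mxP=> i j ij; rewrite mxE A0.
Qed.

Lemma borel_diag_neq0 g i : g \in B -> GLval g i i != 0.
Proof.
move=> gB; have /borelP g0 := gB; apply/eqP=> gii.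
have := GL_det g; rewrite -det_tr det_trig.
  by move/prodf_neq0/(_ i isT); rewrite mxE gii eqxx.
by apply/is_trig_mxP=> k j kj; rewrite mxE g0.
Qed.

Lemma to_GL_unitriangular A : (forall i j, (j < i)%N -> A i j = 0) ->
  (forall i, A i i = 1) -> to_GL A \in U /\ GLval (to_GL A) = A.
Proof.
move=> A0 A1; have AU : A \in unitmx.
  by apply: triangular_unitmx => // i; rewrite A1 oner_neq0.
by rewrite to_GL_K //; split=> //; apply/unitriangularP; rewrite to_GL_K.
Qed.

(** This is permGL, typed in the finite group structure so that products with
    it are formed in that structure. *)
Definition perm_elt s : G := permGL F s.
Local Notation P_ := perm_elt.

Lemma perm_eltE s i j : GLval (P_ s) i j = (s i == j)%:R.
Proof. by rewrite !mxE. Qed.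

Lemma perm_eltM s t : P_ (s * t)%g = (P_ s * P_ t)%g.
Proof. by apply: val_inj; apply: perm_mxM. Qed.

Lemma perm_elt1 : P_ 1%g = 1%g.
Proof. by apply: val_inj; apply: perm_mx1. Qed.

Lemma perm_eltV s : P_ s^-1%g = (P_ s)^-1%g.
Proof. by apply/esym/mulg1_eq; rewrite -perm_eltM mulgV perm_elt1. Qed.

Lemma perm_elt_mull s g i j : GLval (P_ s * g)%g i j = GLval g (s i) j.
Proof.
rewrite GL_entryM (bigD1 (s i)) //= perm_eltE eqxx mul1r big1 ?addr0 // => k ks.
by rewrite perm_eltE eq_sym (negPf ks) mul0r.
Qed.

Lemma perm_elt_mulr s g i j :
  GLval (g * P_ s)%g i j = GLval g i (s^-1%g j).
Proof.
rewrite GL_entryM (bigD1 (s^-1%g j)) //= perm_eltE permKV eqxx mulr1.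
rewrite big1 ?addr0 // => k ks; rewrite perm_eltE.
case: eqP => [kj|]; last by rewrite mulr0.
by rewrite -kj permK eqxx in ks.
Qed.

Lemma perm_elt_conj s t g i j :
  GLval (P_ s * g * (P_ t)^-1)%g i j = GLval g (s i) (t j).
Proof. by rewrite -perm_eltV perm_elt_mulr perm_elt_mull invgK. Qed.

End GroupMatrices.

Section RootElements.
Variables (F : finFieldType) (n : nat).
Local Notation gT := [the finGroupType of {'GL_n[F]}].
Local Notation G := (FinGroup.sort gT).
Local Notation I := 'I_n.-1.+1.
Local Notation B := (borel F n).
Local Notation U := (unitriangular F n).
Local Notation P_ := (@perm_elt F n).
Implicit Types (g h u : G) (A : 'M[F]_n.-1.+1) (i j k l : I) (s t : 'S_n.-1.+1).
Implicit Types (a b c : F) (d : I -> F).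

Definition root_elt i j a : G := to_GL (1%:M + a *: delta_mx i j).

Lemma root_eltP i j a : (i < j)%N -> root_elt i j a \in U /\
  GLval (root_elt i j a) = 1%:M + a *: delta_mx i j.
Proof.
move=> ij; apply: to_GL_unitriangular => [k l lk|k]; rewrite !mxE.
  have /negPf-> : k != l by rewrite neq_ltn lk orbT.
  have /negPf-> : ~~ ((k == i) && (l == j)).
    by apply/negP=> /andP[/eqP ki /eqP lj]; rewrite ki lj ltnNge ltnW in lk.
  by rewrite mulr0 addr0.
have /negPf-> : ~~ ((k == i) && (k == j)).
  by apply/negP=> /andP[/eqP ki /eqP kj]; rewrite -ki kj ltnn in ij.
by rewrite eqxx mulr0 addr0.
Qed.

Lemma root_eltU i j a : (i < j)%N -> root_elt i j a \in U.
Proof. by case/(root_eltP a). Qed.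

Lemma root_eltE i j a k l : (i < j)%N ->
  GLval (root_elt i j a) k l = (k == l)%:R + a * ((k == i) && (l == j))%:R.
Proof. by case/(root_eltP a) => _ ->; rewrite !mxE. Qed.

Lemma root_mull i j a g k l : (i < j)%N ->
  GLval (root_elt i j a * g)%g k l = GLval g k l + a * (k == i)%:R * GLval g j l.
Proof.
move=> ij; rewrite GL_MxE; have [_ ->] := root_eltP a ij.
rewrite mulmxDl mul1mx -scalemxAl !mxE; congr (_ + _).
rewrite -mulrA; congr (_ * _).
rewrite (bigD1 j) //= !mxE eqxx andbT big1 ?addr0 // => m /negPf mj.
by rewrite !mxE mj andbF mul0r.
Qed.

Lemma root_mulr i j a g k l : (i < j)%N ->
  GLval (g * root_elt i j a)%g k l = GLval g k l + a * (l == j)%:R * GLval g k i.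
Proof.
move=> ij; rewrite GL_MxE; have [_ ->] := root_eltP a ij.
rewrite mulmxDr mulmx1 -scalemxAr !mxE; congr (_ + _).
rewrite -mulrA; congr (_ * _).
rewrite (bigD1 i) //= !mxE eqxx mulrC big1 ?addr0 // => m /negPf mj.
by rewrite !mxE mj mulr0.
Qed.

Lemma root_eltD i j a b : (i < j)%N ->
  root_elt i j (a + b) = (root_elt i j a * root_elt i j b)%g.
Proof.
move=> ij; apply: GL_eqP => k l; rewrite root_mulr // !root_eltE //.
have /negPf ij' : i != j by rewrite neq_ltn ij.
rewrite ij' andbF mulr0 addr0 mulrDl -addrA; congr (_ + (_ + _)).
by rewrite -mulrA -natrM mulnb andbC.
Qed.

Lemma root_elt0 i j : (i < j)%N -> root_elt i j 0 = 1%g.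
Proof.
by move=> ij; apply: GL_eqP => k l; rewrite root_eltE // mul0r addr0 GL_one.
Qed.

Lemma root_eltN i j a : (i < j)%N -> root_elt i j (- a) = (root_elt i j a)^-1%g.
Proof.
by move=> ij; apply/esym/mulg1_eq; rewrite -root_eltD // subrr root_elt0.
Qed.

Definition torus_elt d : G := to_GL (\matrix_(k, l) (d k * (k == l)%:R)).

Lemma torus_eltE d k l : (forall m, d m != 0) ->
  GLval (torus_elt d) k l = d k * (k == l)%:R.
Proof.
move=> d0; rewrite to_GL_K ?mxE //.
apply: triangular_unitmx => [i j ji|i]; rewrite !mxE.
  by rewrite -val_eqE /= gtn_eqF // mulr0.
by rewrite eqxx mulr1.
Qed.

Lemma torus_mull d g k l : (forall m, d m != 0) ->
  GLval (torus_elt d * g)%g k l = d k * GLval g k l.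
Proof.
move=> d0; rewrite GL_entryM (bigD1 k) //= torus_eltE // eqxx mulr1.
rewrite big1 ?addr0 // => m /negPf mk.
by rewrite torus_eltE // eq_sym mk mulr0 mul0r.
Qed.

Lemma torus_mulr d g k l : (forall m, d m != 0) ->
  GLval (g * torus_elt d)%g k l = GLval g k l * d l.
Proof.
move=> d0; rewrite GL_entryM (bigD1 l) //= torus_eltE // eqxx mulr1.
rewrite big1 ?addr0 // => m /negPf ml.
by rewrite torus_eltE // ml mulr0 mulr0.
Qed.

Lemma torus_conj d g k l : (forall m, d m != 0) ->
  GLval (g ^ torus_elt d)%g k l = GLval g k l * d l / d k.
Proof.
move=> d0; apply: (mulfI (d0 k)); rewrite -torus_mull // -conjgC torus_mulr //.
by rewrite mulrCA divff ?mulr1.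
Qed.

Lemma borel_factor g : g \in B -> exists2 u, u \in U &
  exists2 d, (forall m, d m != 0) & g = (u * torus_elt d)%g.
Proof.
move=> gB; pose d k := GLval g k k.
have d0 k : d k != 0 by apply: borel_diag_neq0.
exists (g * (torus_elt d)^-1)%g; last by exists d; rewrite ?mulgKV.
have entry k l : GLval (g * (torus_elt d)^-1)%g k l = GLval g k l / d l.
  by apply: (mulIf (d0 l)); rewrite -torus_mulr // mulgKV divfK.
have /borelP g0 := gB; apply/unitriangularP; split=> [k l lk|k]; rewrite entry.
  by rewrite g0 ?mul0r.
by rewrite divff ?d0.
Qed.

Lemma torus_normalizes d u : (forall m, d m != 0) ->
  u \in U -> (u ^ torus_elt d)%g \in U.
Proof.
move=> d0 /unitriangularP[u0 u1]; apply/unitriangularP.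
split=> [k l lk|k]; rewrite torus_conj //; first by rewrite u0 // !mul0r.
by rewrite u1 mul1r divff.
Qed.

(** The Bruhat decomposition of the lower triangular element s x(a) s in the
    rank one group of the pair (i, j). *)
Lemma rank_one_identity i j a (s := P_ (tperm i j)) : (i < j)%N -> a != 0 ->
  exists2 b, (forall k l, k != l -> (k, l) != (i, j) -> GLval b k l = 0) &
    (s * root_elt i j a * s = root_elt i j (a^-1)%R * s * b)%g.
Proof.
move=> ij a0; have ij' : i != j by rewrite neq_ltn ij.
have ji' : (j == i) = false by rewrite eq_sym (negPf ij').
pose D := \matrix_(k, l) (if (k, l) == (i, j) then 1 else
  (k == l)%:R * (if k == i then a else if k == j then - a^-1 else 1))
  : 'M[F]_n.-1.+1.
have DU : D \in unitmx.
  apply: triangular_unitmx => [k l lk|k]; rewrite mxE xpair_eqE.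
    have /negPf-> : ~~ ((k == i) && (l == j)).
      by apply/negP=> /andP[/eqP ki /eqP lj]; rewrite ki lj ltnNge ltnW in lk.
    have /negPf-> : k != l by rewrite neq_ltn lk orbT.
    by rewrite mul0r.
  have /negPf-> : ~~ ((k == i) && (k == j)).
    by apply/negP=> /andP[/eqP ki /eqP kj]; rewrite -ki kj ltnn in ij.
  rewrite eqxx mul1r; case: (k == i) => //.
  by case: (k == j); rewrite ?oner_neq0 // oppr_eq0 invr_neq0.
exists (to_GL D) => [k l /negPf kl /negPf klij|].
  by rewrite to_GL_K // mxE klij kl mul0r.
apply: GL_eqP => k l; rewrite perm_elt_mulr perm_elt_mull -mulgA root_mull //.
rewrite !perm_elt_mull tpermR tpermV to_GL_K // root_eltE // !mxE !xpair_eqE.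
have [ni nj] := (negPf ij', ji').
case: (tpermP i j k) => [->|->|/eqP/negPf ki /eqP/negPf kj];
  case: (tpermP i j l) => [->|->|/eqP/negPf li /eqP/negPf lj];
  rewrite ?eqxx ?ni ?nj ?ki ?kj ?li ?lj ?[_ == l]eq_sym;
  rewrite ?ni ?nj ?ki ?kj ?li ?lj /=;
  rewrite ?(mulr0, mulr1, mul0r, mul1r, addr0, add0r) ?mulVf ?addNr //.
Qed.

End RootElements.

(** By Cayley-Hamilton u - 1 is nilpotent, so u has p-power order. *)
Lemma unitriangular_pgroup (F : finFieldType) (n p : nat) :
  p \in [pchar F] -> (p.-group (unitriangular F n))%g.
Proof.
move=> charF; have p_pr := pcharf_prime charF.
apply/pgroupP=> r r_pr r_dvd.
have [u uU ur] := Cauchy (G := [group of unitriangular F n]) r_pr r_dvd.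
have /unitriangularP[u0 u1] := uU.
pose A := (GLval u)^T; pose N := n.-1.+1.
have charA : char_poly A = ('X - 1) ^+ N.
  rewrite char_poly_trig => [|]; last first.
    by apply/is_trig_mxP=> i j ij; rewrite mxE u0.
  under eq_bigr do rewrite mxE u1.
  by rewrite prodr_const card_ord.
have AK : horner_mx A (('X - 1) ^+ (p ^ N)) = 0.
  have leN : (N <= p ^ N)%N by rewrite ltnW // ltn_expl // prime_gt1.
  by rewrite -(subnK leN) exprD rmorphM /= -charA Cayley_Hamilton mulr0.
have pX : 'X ^+ (p ^ N) = ('X - 1) ^+ (p ^ N) + 1 :> {poly F}.
  have pN : ([pchar {poly F}].-nat (p ^ N))%N.
    by rewrite pnatX pnatE // pchar_lalg charF.
  by rewrite -{1}['X](subrK 1) exprDn_pchar // expr1n.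
have trX m : (A ^+ m)^T = GLval u ^+ m.
  elim: m => [|m IHm]; first exact: trmx1.
  by rewrite exprS exprSr trmx_mul IHm trmxK.
have uK : (u ^+ (p ^ N) = 1)%g.
  have := congr1 (horner_mx A) pX.
  rewrite rmorphXn rmorphD rmorph1 /= horner_mx_X AK add0r => /(congr1 trmx).
  by rewrite trX trmx1 => uX; apply: val_inj; rewrite /= FinRing.val_unitX.
have : (r %| p ^ N)%N by rewrite -ur order_dvdn uK.
by rewrite Euclid_dvdX // dvdn_prime2 // => /andP[/eqP-> _]; rewrite inE.
Qed.

(** * The Steinberg lattice *)

Section SteinbergLattice.
Variables (F : finFieldType) (n : nat) (R : idomainType).
Local Notation gT := [the finGroupType of {'GL_n[F]}].
Local Notation G := (FinGroup.sort gT).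
Local Notation I := 'I_n.-1.+1.
Local Notation B := (borel F n).
Local Notation U := (unitriangular F n).
Local Notation P_ := (@perm_elt F n).
Local Notation RG := (galg R gT).
Local Notation eps := (steinberg_elt F n R : RG).
Local Notation Bsum := (gsum R B : RG).
Local Notation sumU := (@weighted_sum R gT U).
Implicit Types (g h u v : G) (i j k l : I) (s t : 'S_n.-1.+1).
Implicit Types (a b c : F) (d : I -> F) (f : G -> R).

Lemma borel_sum_absorb h : h \in B -> gelt R h * Bsum = Bsum.
Proof.
move=> bB; apply/ffunP=> g; rewrite gelt_mulE !gsumE.
by rewrite groupMl // groupV.
Qed.

Lemma flag_absorb g t : ((P_ t)^-1 * g * P_ t)%g \in B ->
  gelt R g * (gelt R (P_ t) * Bsum) = gelt R (P_ t) * Bsum.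
Proof.
by move=> gB; apply: (@gelt_conj_absorb R gT g (P_ t)); apply: borel_sum_absorb.
Qed.

Lemma steinbergE g :
  eps g = \sum_(s : 'S_n.-1.+1) (-1) ^+ s * (((P_ s)^-1 * g)%g \in B)%:R.
Proof.
by rewrite galg_sumE; apply: eq_bigr => s _; rewrite ffunE gelt_mulE gsumE.
Qed.

Lemma steinberg_mulr g h : h \in B -> eps (g * h)%g = eps g.
Proof.
move=> hB; rewrite !steinbergE; apply: eq_bigr => s _; congr (_ * (_ : bool)%:R).
by rewrite (mulgA (P_ s)^-1%g) groupMr.
Qed.

Lemma steinberg_perm s : gelt R (P_ s) * eps = (-1) ^+ s *: eps.
Proof.
rewrite scaler_sumr big_distrr [RHS](reindex_inj (mulgI s)) /=.
apply: eq_bigr => t _; rewrite -galg_scaleAr gelt_mulA -perm_eltM scalerA.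
by rewrite odd_permM signr_addb mulrA -signr_addb addbb mul1r.
Qed.

Lemma steinberg_torus d : (forall m, d m != 0) ->
  gelt R (torus_elt d) * eps = eps.
Proof.
move=> d0; rewrite big_distrr; apply: eq_bigr => t _ /=.
rewrite -galg_scaleAr flag_absorb //; apply/borelP=> i j ji.
rewrite -{2}[P_ t]invgK -perm_eltV perm_elt_conj torus_eltE // (inj_eq perm_inj).
by rewrite -val_eqE /= gtn_eqF // mulr0.
Qed.

(** One permutation t is kept in each coset of the group generated by the
    transposition (i, j): the one for which t^-1 x_ij t is upper triangular,
    so that the root subgroup of (i, j) fixes the sum. *)
Definition half_steinberg i j : RG :=
  \sum_(t : 'S_n.-1.+1 | (t i < t j)%N) (-1) ^+ t *: (gelt R (P_ t) * Bsum).

Lemma steinberg_split i j : i != j ->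
  eps = half_steinberg i j - gelt R (P_ (tperm i j)) * half_steinberg i j.
Proof.
move=> ij; rewrite /steinberg_elt.
rewrite (bigID (fun t : 'S_n.-1.+1 => (t i < t j)%N)) /=.
congr (_ + _); rewrite /half_steinberg big_distrr /= -sumrN.
rewrite (reindex_inj (mulgI (tperm i j))) /=; apply: eq_big => [t|t _].
  rewrite !permM tpermL tpermR -leqNgt leq_eqVlt.
  by rewrite (inj_eq val_inj) (inj_eq perm_inj) (negPf ij).
rewrite -galg_scaleAr gelt_mulA -perm_eltM odd_permM odd_tperm ij /=.
by rewrite signrN scaleNr.
Qed.

Lemma half_steinberg_absorb i j g :
    (forall k l, k != l -> (k, l) != (i, j) -> GLval g k l = 0) ->
  gelt R g * half_steinberg i j = half_steinberg i j.
Proof.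
move=> g0; rewrite big_distrr; apply: eq_bigr => t tij /=.
rewrite -galg_scaleAr flag_absorb //; apply/borelP=> k l lk.
rewrite -{2}[P_ t]invgK -perm_eltV perm_elt_conj g0 //.
  by rewrite (inj_eq perm_inj) neq_ltn lk orbT.
apply: contraTneq lk => -[ki lj].
by rewrite -[k](permKV t) -[l](permKV t) ki lj -leqNgt ltnW.
Qed.

(** Write eps = H - s H with H fixed by the Borel subgroup of the rank one
    group, and use the Bruhat decomposition of s x(a) s. *)
Lemma rank_one_relation i j a : (i < j)%N -> a != 0 ->
  gelt R (P_ (tperm i j)) * (gelt R (root_elt i j a) * eps) =
  gelt R (root_elt i j (a^-1)%R) * eps - eps.
Proof.
move=> ij a0; have ij' : i != j by rewrite neq_ltn ij.
pose H := half_steinberg i j; set s := P_ (tperm i j).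
have xH c : gelt R (root_elt i j c) * H = H.
  apply: half_steinberg_absorb => k l /negPf kl klij.
  by rewrite root_eltE // kl add0r -xpair_eqE (negPf klij) mulr0.
have [b b0 sxs] := rank_one_identity ij a0.
have bH : gelt R b * H = H by apply: half_steinberg_absorb.
have ss : (s * s)%g = 1%g by rewrite -perm_eltM tperm2 perm_elt1.
rewrite (steinberg_split ij').
exact: (rank_one_module_relation ss sxs (xH _) (xH _) bH).
Qed.

Lemma perm_le_id s : (forall i, s i <= i)%N -> s = 1%g.
Proof.
move=> s_le; apply/permP=> i; rewrite perm1.
suff s_fix m : forall k, (k < m)%N -> s k = k by apply: (s_fix i.+1).
elim: m => // m IHm k; rewrite ltnS => km.
have [lt_sk|] := ltnP (s k) k; last first.
  by move=> le_ks; apply/val_inj/eqP; rewrite eqn_leq le_ks s_le.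
by apply: (perm_inj (s := s)); apply: IHm; apply: leq_trans km.
Qed.

(** A nonzero entry of a permuted unitriangular matrix sits at each (i, s^-1 t i),
    so s^-1 t can only move indices upwards and must be trivial. *)
Lemma cells_disjoint u s t :
  u \in U -> (P_ t * u * (P_ s)^-1)%g \in B -> t = s.
Proof.
move=> /unitriangularP[u0 u1] /borelP tusB.
suff st1 : (t * s^-1)%g = 1%g by apply/eqP; rewrite eq_mulgV1 st1.
have H i : (i <= (t * s^-1)%g i)%N.
  rewrite leqNgt; apply/negP=> lt_i; move: (tusB _ _ lt_i).
  rewrite perm_elt_conj permM permKV u1 => /eqP.
  by rewrite oner_eq0.
rewrite -[LHS]invgK -[RHS]invgK; congr (_^-1)%g; rewrite invg1.
apply: perm_le_id => i; apply: leq_trans (H _) _.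
by rewrite permKV.
Qed.

Lemma steinberg_cellE u s : u \in U ->
  eps (u * (P_ s)^-1)%g = (-1) ^+ s * ((P_ s * u * (P_ s)^-1)%g \in B)%:R.
Proof.
move=> uU; rewrite steinbergE (reindex_inj invg_inj) (bigD1 s) //=.
rewrite perm_eltV invgK odd_permV mulgA big1 ?addr0 // => t ts.
rewrite perm_eltV invgK mulgA.
case: (boolP (_ \in B)) => [/(cells_disjoint uU) tE|_].
  by rewrite tE eqxx in ts.
by rewrite mulr0.
Qed.

Lemma span_stable g :
    (forall u, u \in U -> exists f, gelt R g * (gelt R u * eps) = sumU f * eps) ->
  forall f, exists f', gelt R g * (sumU f * eps) = sumU f' * eps.
Proof.
move=> gU f.
have /boolp.choice[f' f'P] u : exists f', u \in U ->
    gelt R g * (gelt R u * eps) = sumU f' * eps.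
  have [/gU[f' f'P]|_] := boolP (u \in U); first by exists f'.
  by exists (fun=> 0).
exists (fun v => \sum_(u in U) f u * f' u v).
rewrite weighted_sumMl big_distrr weighted_sumMl /=.
transitivity (\sum_(u in U) \sum_(v in U) (f u * f' u v) *: (gelt R v * eps)).
  apply: eq_bigr => u uU; rewrite -galg_scaleAr f'P // weighted_sumMl.
  by rewrite scaler_sumr; apply: eq_bigr => v _; rewrite scalerA.
by rewrite exchange_big; apply: eq_bigr => v _; rewrite scaler_suml.
Qed.

Lemma gelt_span u : u \in U -> exists f, gelt R u * eps = sumU f * eps.
Proof.
move=> uU; exists (fun v => (v == u)%:R).
rewrite weighted_sumMl (bigD1 u) //= eqxx scale1r big1 ?addr0 //.
by move=> v /andP[_ /negPf->]; rewrite scale0r.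
Qed.

Lemma borel_span g u : g \in B -> u \in U ->
  exists f, gelt R g * (gelt R u * eps) = sumU f * eps.
Proof.
move=> gB uU; have /borel_factor[v vU [d d0 guE]] : (g * u)%g \in B.
  by rewrite borelM // (subsetP (unitriangular_sub_borel _ _)).
have [f fE] := gelt_span vU; exists f.
by rewrite gelt_mulA guE -gelt_mulA steinberg_torus.
Qed.

(** Split u = w x with x in the simple root subgroup and s w s in U; the rank
    one relation then expresses s x eps. *)
Lemma simple_reflection_span i j u : j = i.+1 :> nat -> u \in U ->
  exists f, gelt R (P_ (tperm i j)) * (gelt R u * eps) = sumU f * eps.
Proof.
move=> ji uU; have ij : (i < j)%N by rewrite ji.
pose a := GLval u i j; pose x := root_elt i j a.
set s := P_ (tperm i j).
have xU : x \in U by apply: root_eltU.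
pose v := (s * (u * x^-1) * s)%g.
have sE : s^-1%g = s by rewrite /s -perm_eltV tpermV.
have vU : v \in U.
  rewrite /v -{2}sE; have /unitriangularP[w0 w1] : (u * x^-1)%g \in U.
    by rewrite unitriangularM ?unitriangularV.
  have wij : GLval (u * x^-1)%g i j = 0.
    have /unitriangularP[_ u1] := uU.
    by rewrite /x -root_eltN // root_mulr // u1 eqxx !mulr1 subrr.
  apply/unitriangularP; split=> [k l lk|k]; rewrite perm_elt_conj; last exact: w1.
  have [lt_s|le_s] := ltnP (tperm i j l) (tperm i j k); first exact: w0.
  suff [-> ->] : tperm i j k = i /\ tperm i j l = j by [].
  move: le_s lk; rewrite leq_eqVlt (inj_eq val_inj) (inj_eq perm_inj) => + lk.
  rewrite -val_eqE /= gtn_eqF //=.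
  case: (tpermP i j k) => [/(congr1 val)|/(congr1 val)|/eqP + /eqP];
    case: (tpermP i j l) => [/(congr1 val)|/(congr1 val)|/eqP + /eqP];
    rewrite -?val_eqE /=; by [|lia].
have ss : (s * s)%g = 1%g by rewrite -perm_eltM tperm2 perm_elt1.
rewrite (gelt_involution_twist u x eps ss) -/v.
have [f fE] := gelt_span vU.
have [a0|a_neq0] := eqVneq a 0.
  exists (fun w => - f w); rewrite /x a0 root_elt0 // mul1r steinberg_perm.
  rewrite odd_tperm neq_ltn ij expr1 scaleN1r mulrN fE !weighted_sumMl -sumrN.
  by apply: eq_bigr => w _; rewrite scaleNr.
have xvU : (v * root_elt i j (a^-1)%R)%g \in U.
  by rewrite unitriangularM ?root_eltU.
have [f' f'E] := gelt_span xvU.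
exists (fun w => f' w - f w); rewrite rank_one_relation // mulrBr mulrA -geltM.
rewrite fE f'E !weighted_sumMl -sumrB.
by apply: eq_bigr => w _; rewrite scalerBl.
Qed.

(** The span of the translates of eps by U is stable under B and under the
    simple reflections, which generate G. *)
Lemma steinberg_span (lam : G -> R) g : parabolic lam = [set: G] ->
  exists f, gelt R g * eps = sumU f * eps.
Proof.
move=> Plam.
pose S := [set g : G | `[< forall f, exists f',
  gelt R g * (sumU f * eps) = sumU f' * eps >]].
have S_group : group_set S.
  apply/group_setP; split=> [|g1 g2]; rewrite !inE.
    by apply/asboolP=> f; exists f; rewrite mul1r.
  move=> /asboolP g1S /asboolP g2S; apply/asboolP=> f.
  have [f2 f2E] := g2S f; have [f1 f1E] := g1S f2; exists f1.
  by rewrite geltM -mulrA f2E.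
have: g \in parabolic lam by rewrite Plam inE.
have sPS : parabolic lam \subset Group S_group.
  rewrite gen_subG subUset; apply/andP; split; apply/subsetP=> h.
    move=> hB; rewrite inE; apply/asboolP; apply: span_stable => u.
    exact: borel_span.
  rewrite !inE => /existsP[i /existsP[j /and3P[/eqP ji _ /eqP->]]].
  apply/asboolP; apply: span_stable => u; exact: simple_reflection_span.
move/(subsetP sPS); rewrite inE => /asboolP gS.
have [f fE] := gelt_span (group1 [group of U]).
by have [f' f'E] := gS f; exists f'; rewrite -f'E -fE mul1r.
Qed.

Lemma weighted_sum_char (mu : G -> R) v : linear_character mu -> v \in U ->
  sumU mu * gelt R v = mu (v^-1)%g *: sumU mu.
Proof.
by move=> [_ muM]; apply: (@weighted_sum_mulr_eigen R gT [group of U]).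
Qed.

(** The mu-eigenspace of U on the lattice is spanned by the vector attached
    to mu, because the lattice is a quotient of the regular module of U. *)
Lemma eigenspace_span (lam mu : G -> R) (x : RG) :
    parabolic lam = [set: G] -> linear_character mu ->
  exists c : R, sumU mu * (x * eps) = c *: (sumU mu * eps).
Proof.
move=> Plam mu_char.
apply: scalar_action_ext => g; have [f ->] := steinberg_span g Plam.
exists (\sum_(v in U) f v * mu (v^-1)%g).
rewrite [sumU f * _]weighted_sumMl big_distrr scaler_suml.
apply: eq_bigr => v vU /=.
by rewrite -galg_scaleAr mulrA weighted_sum_char // -galg_scaleAl scalerA.
Qed.

End SteinbergLattice.

(** * Linear characters of the unitriangular group *)

Section LinearCharacters.
Variables (F : finFieldType) (n : nat) (R : idomainType).
Local Notation gT := [the finGroupType of {'GL_n[F]}].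
Local Notation G := (FinGroup.sort gT).
Local Notation I := 'I_n.-1.+1.
Local Notation U := (unitriangular F n).
Local Notation P_ := (@perm_elt F n).
Implicit Types (g h u v : G) (i j k l m : I) (s t : 'S_n.-1.+1).
Implicit Types (a b c : F) (lam mu nu : G -> R).

Lemma linear_character1 mu : linear_character mu -> mu 1%g = 1.
Proof.
move=> [muU muM]; have mu1 := muU _ (group1 [group of U]).
by apply: (mulrI mu1); rewrite mulr1 -muM ?mulg1 ?group1.
Qed.

(** A missing simple reflection would leave the whole group inside a proper
    block triangular one. *)
Lemma parabolic_full_nontrivial lam i j : j = i.+1 :> nat ->
  parabolic lam = [set: G] -> exists a, lam (root_elt i j a) != 1.
Proof.
move=> ji Plam; have ij : (i < j)%N by rewrite ji.
case: (boolP [exists a, lam (root_elt i j a) != 1]) => [/existsP//|].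
rewrite negb_exists => /forallP lam1.
pose Q := [set g : G | [forall k : I, forall l : I,
  (l <= i < k)%N ==> (GLval g k l == 0)]].
have QP g : reflect (forall k l : I, (l <= i < k)%N -> GLval g k l = 0) (g \in Q).
  rewrite inE; apply: (iffP forallP) => [gQ k l lik|g0 k].
    by apply/eqP; move/forallP/(_ l)/implyP/(_ lik): (gQ k).
  by apply/forallP=> l; apply/implyP=> lik; rewrite g0.
have Q_group : group_set Q.
  apply/group_setP; split=> [|g h /QP g0 /QP h0]; apply/QP=> k l /andP[li ik].
    by rewrite GL_one; case: eqP => // kl; rewrite kl ltnNge li in ik.
  rewrite GL_entryM big1 // => m _; have [mi|im] := leqP m i.
    by rewrite g0 ?mul0r // mi.
  by rewrite h0 ?mulr0 // li.
have sPQ : parabolic lam \subset Group Q_group.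
  rewrite gen_subG subUset; apply/andP; split; apply/subsetP=> h.
    move=> /borelP h0; apply/QP=> k l /andP[li ik]; apply: h0.
    exact: leq_ltn_trans ik.
  rewrite inE => /existsP[i' /existsP[j' /and3P[/eqP ji' ntlam /eqP->]]].
  have [eq_i|neq_i] := eqVneq i' i.
    have eq_j : j' = j by apply: val_inj; rewrite /= ji ji' eq_i.
    case/existsP: ntlam => u; rewrite inE eq_i eq_j => /andP[/existsP[a /eqP ua]].
    suff -> : u = root_elt i j a by rewrite (eqP (negbNE (lam1 a))) eqxx.
    by apply/val_inj; rewrite /= ua; case: (root_eltP a ij).
  apply/QP=> k l /andP[li ik]; rewrite perm_eltE; case: eqP => // kl; exfalso.
  move: kl; rewrite -val_eqE /= in neq_i.
  move: ik; case: (tpermP i' j' k) => [->|->|_ _] ?;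
    by move/(congr1 (@nat_of_ord _)); lia.
have /(subsetP sPQ)/QP/(_ j i) : P_ (tperm i j) \in parabolic lam.
  by rewrite Plam inE.
rewrite leqnn ij => /(_ isT)/eqP; rewrite perm_eltE tpermR eqxx.
by rewrite oner_eq0.
Qed.

(** The root element is a commutator as soon as the root is a sum of two. *)
Lemma linear_character_nonsimple mu i m k a : linear_character mu ->
  (i < m)%N -> (m < k)%N -> mu (root_elt i k a) = 1.
Proof.
move=> [muU muM] im mk; have ik := ltn_trans im mk.
pose x := root_elt i m a; pose y := root_elt m k (1 : F).
pose z := root_elt i k a.
have [xU yU zU] : [/\ x \in U, y \in U & z \in U] by rewrite !root_eltU.
have xy : (x * y)%g = (y * x * z)%g.
  apply: GL_eqP => r l; rewrite !root_mulr // !root_eltE //.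
  have /negPf ki : k != i by rewrite neq_ltn ik orbT.
  have /negPf mi : m != i by rewrite neq_ltn im orbT.
  have /negPf mk' : m != k by rewrite neq_ltn mk.
  have /negPf im' : i != m by rewrite neq_ltn im.
  have /negPf ik' : i != k by rewrite neq_ltn ik.
  rewrite eqxx im' ik' !andbF !andbT.
  rewrite -!mulnb !natrM !mulr0n !(mulr0, addr0, mul1r).
  by ring.
have := congr1 mu xy; rewrite !muM ?unitriangularM // mulrC => /esym.
by rewrite -[RHS]mulr1; apply: mulrI; rewrite unitrM !muU.
Qed.

(** Multiplication by root elements clears the entries of a unitriangular
    matrix column by column, so the root elements generate U. *)
Lemma linear_character_ext mu nu : linear_character mu -> linear_character nu ->
    (forall i j a, j = i.+1 :> nat ->
       mu (root_elt i j a) = nu (root_elt i j a)) ->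
  {in U, mu =1 nu}.
Proof.
move=> mu_char nu_char mu_nu u uU.
have roots i j a : (i < j)%N -> mu (root_elt i j a) = nu (root_elt i j a).
  move=> ij; have [ji|ne_ji] := eqVneq (j : nat) i.+1; first exact: mu_nu.
  have lt_ij : (i.+1 < j)%N by rewrite ltn_neqAle eq_sym ne_ji.
  pose m : I := Ordinal (ltn_trans lt_ij (ltn_ord j)).
  have im : (i < m)%N by rewrite /=.
  by rewrite !(@linear_character_nonsimple _ i m j).
pose supp (w : G) := [set p : I * I | (p.1 < p.2)%N && (GLval w p.1 p.2 != 0)].
have [N leN] := ubnP #|supp u|; elim: N => // N IHN in u uU leN *.
have [/eqP supp0|[p0 p0u]] := set_0Vmem (supp u).
  suff -> : u = 1%g by rewrite !linear_character1.
  have /unitriangularP[u0 u1] := uU.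
  apply: GL_eqP => i j; rewrite GL_one.
  have [ij|ji|/val_inj->] := ltngtP i j; last by rewrite u1 eqxx.
    have /setP/(_ (i, j)) := eqP supp0; rewrite !inE /= ij => /negbFE/eqP->.
    by rewrite -val_eqE ltn_eqF.
  by rewrite u0 // -val_eqE gtn_eqF.
case: (@arg_minnP _ p0 [in supp u] (fun p => p.2 : nat) p0u) => -[i k] /=.
rewrite inE /= => /andP[ik uik0] kmin; have /unitriangularP[u0 u1] := uU.
pose c := GLval u i k; pose x := root_elt i k c.
have xU : x \in U by apply: root_eltU.
have ui r : GLval u r i = (r == i)%:R.
  have [ri|ir|/val_inj->] := ltngtP r i; last by rewrite u1 eqxx.
    rewrite -val_eqE ltn_eqF //; apply/eqP; apply: contraTT ik => uri0.
    by rewrite -leqNgt; apply: (kmin (r, i)); rewrite inE /= ri.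
  by rewrite u0 // -val_eqE gtn_eqF.
pose v := (u * x^-1)%g.
have vE r l : GLval v r l = GLval u r l - c * ((r == i) && (l == k))%:R.
  by rewrite /v -root_eltN // root_mulr // ui !mulNr -mulrA -natrM mulnb andbC.
have vU : v \in U by rewrite unitriangularM ?unitriangularV.
have uE : u = (v * x)%g by rewrite mulgKV.
have supp_v : (#|supp v| < N)%N.
  rewrite -ltnS; apply: leq_trans leN; rewrite ltnS; apply: proper_card.
  apply/properP; split.
    apply/subsetP=> -[r l]; rewrite !inE /= vE => /andP[->] /=.
    by case: (altP andP) => [[/eqP-> /eqP->] _|_]; rewrite ?mulr0 ?subr0.
  by exists (i, k); rewrite !inE /= ?ik // vE !eqxx mulr1 subrr eqxx.
have [[_ muM] [_ nuM]] := (mu_char, nu_char).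
by rewrite uE (muM v x) // (nuM v x) // (IHN v) // roots.
Qed.

End LinearCharacters.

Section SimpleCharacters.
Variables (F : finFieldType) (n : nat) (R : idomainType).
Local Notation gT := [the finGroupType of {'GL_n[F]}].
Local Notation G := (FinGroup.sort gT).
Local Notation I := 'I_n.-1.+1.
Local Notation U := (unitriangular F n).
Local Notation eps := (steinberg_elt F n R : galg R gT).
Local Notation sumU := (@weighted_sum R gT U).
Implicit Types (g h u v : G) (i j k l m : I).
Implicit Types (a b c : F) (lam mu nu : G -> R) (t : I -> F) (chi : F -> R).

Definition superdiagonal t u : F :=
  \sum_(p : I * I | p.2 == p.1.+1 :> nat) t p.2 * GLval u p.1 p.2.

Lemma unitriangular_superdiagonalM u v i j : j = i.+1 :> nat ->
    u \in U -> v \in U ->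
  GLval (u * v)%g i j = GLval u i j + GLval v i j.
Proof.
move=> ji /unitriangularP[u0 u1] /unitriangularP[v0 v1].
have ij : i != j by rewrite -val_eqE /= ji ltn_eqF.
rewrite GL_entryM (bigD1 i) // (bigD1 j) 1?eq_sym //= u1 v1 mul1r mulr1.
rewrite big1 => [|k /andP[ki kj]]; first by rewrite addr0 addrC.
have [lt_ki|le_ik] := ltnP k i; first by rewrite u0 ?mul0r.
rewrite v0 ?mulr0 //; rewrite -val_eqE /= in ki; rewrite -val_eqE /= in kj.
by lia.
Qed.

Lemma superdiagonalM t u v : u \in U -> v \in U ->
  superdiagonal t (u * v)%g = superdiagonal t u + superdiagonal t v.
Proof.
move=> uU vU; rewrite -big_split; apply: eq_bigr => p /eqP pE /=.
by rewrite unitriangular_superdiagonalM // mulrDr.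
Qed.

Lemma superdiagonal_root t i j a : j = i.+1 :> nat ->
  superdiagonal t (root_elt i j a) = t j * a.
Proof.
move=> ji; have ij : (i < j)%N by rewrite ji.
rewrite /superdiagonal (bigD1 (i, j)) /= ?ji // big1 ?addr0 => [|[k l] /=].
  by rewrite root_eltE // !eqxx -val_eqE /= ltn_eqF // add0r mulr1.
case/andP=> /eqP lk; rewrite xpair_eqE => /negPf kl; rewrite root_eltE // kl.
by rewrite -val_eqE /= lk ltn_eqF // mulr0 addr0 mulr0.
Qed.

Definition simple_character chi t u : R := chi (superdiagonal t u).

Lemma simple_character_linear chi t : additive_character chi ->
  linear_character (simple_character chi t).
Proof.
move=> [chi0 chiD]; split=> [u uU|u v uU vU].
  apply/unitrPr; exists (chi (- superdiagonal t u)).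
  by rewrite -chiD subrr chi0.
by rewrite /simple_character superdiagonalM.
Qed.

Lemma root_character lam i j : (i < j)%N -> linear_character lam ->
  additive_character (fun a => lam (root_elt i j a)).
Proof.
move=> ij lam_char; split; first by rewrite root_elt0 // linear_character1.
by have [_ lamM] := lam_char; move=> a b; rewrite root_eltD // lamM ?root_eltU.
Qed.

(** On each simple root subgroup lam is a multiple chi (t_j a) of one and the
    same additive character, and it is determined by these restrictions. *)
Lemma linear_character_simple lam : (2 <= n)%N -> linear_character lam ->
    (forall i j, j = i.+1 :> nat -> exists a, lam (root_elt i j a) != 1) ->
    (#|F|%:R != 0 :> R) ->
  exists chi t, [/\ additive_character chi, exists a, chi a != 1,
    forall j, t j != 0 & {in U, lam =1 simple_character chi t}].
Proof.
move=> n2 lam_char lam_nt q0.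
have lt1n : (1 < n.-1.+1)%N by case: (n) n2 => [|[|]].
pose j0 : I := Ordinal lt1n; pose chi a := lam (root_elt ord0 j0 a).
have chi_char : additive_character chi by apply: root_character.
have chi_nt : exists a, chi a != 1 by apply: lam_nt.
have /boolp.choice[t tP] j : exists t : F, t != 0 /\
    forall i a, j = i.+1 :> nat -> lam (root_elt i j a) = chi (t * a).
  have [j_eq0|j_gt0] := posnP j.
    by exists 1; rewrite oner_neq0; split=> // i a; rewrite j_eq0.
  have ltj : (j.-1 < n.-1.+1)%N.
    by apply: leq_ltn_trans (ltn_ord j); apply: leq_pred.
  have ji : j = (Ordinal ltj).+1 :> nat by apply/esym/prednK.
  have lt_ij : (Ordinal ltj < j)%N by rewrite [X in (_ < X)%N]ji.
  have [t t0 tE] := additive_character_multiple chi_char chi_nt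
    (root_character lt_ij lam_char) (lam_nt _ _ ji) q0.
  exists t; split=> // i a jiE.
  by have -> : i = Ordinal ltj by apply: val_inj; rewrite /= jiE.
exists chi, t; split=> // [j|]; first by case: (tP j).
apply: linear_character_ext => // [|i j a ji].
  exact: simple_character_linear.
by have [_ ->//] := tP j; rewrite /simple_character superdiagonal_root.
Qed.

(** Conjugation by a diagonal matrix d multiplies the entry (i, j) by d_j / d_i;
    take d_j / d_i = 1 / t_j along the superdiagonal. *)
Lemma simple_character_normalize chi t (x : (galg R gT)^o) :
    (forall j, t j != 0) ->
    sumU (simple_character chi t) * eps \in cyclic_sub x ->
  sumU (simple_character chi (fun=> 1)) * eps \in cyclic_sub x.
Proof.
move=> t0 tx; pose d (j : I) := \prod_(m : I | (m <= j)%N) (t m)^-1.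
have d0 j : d j != 0 by apply/prodf_neq0 => m _; rewrite invr_eq0.
have -> : sumU (simple_character chi (fun=> 1)) =
          sumU (fun u => simple_character chi t (u ^ torus_elt d)%g).
  apply: eq_bigr => u _; congr (chi _ *: _); apply: eq_bigr => -[i j] /= /eqP ji.
  rewrite torus_conj // mul1r mulrCA mulrA.
  have -> : d j = d i / t j.
    rewrite /d (bigD1 j) //= mulrC; congr (_ / _); apply: eq_bigl => m.
    by rewrite -val_eqE /=; lia.
  by rewrite -(mulrA _ (d i / _)) divfK // mulfK.
rewrite weighted_sum_conj => [|u uU]; last exact: torus_normalizes.
have epsV : gelt R (torus_elt d)^-1%g * eps = eps.
  by rewrite -[in LHS](steinberg_torus R d0) mulrA -geltM mulVg mul1r.
by rewrite -2!mulrA epsV; apply: cyclic_subM.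
Qed.

End SimpleCharacters.

(** * From regular to degenerate characters *)

Section DegenerateCharacters.
Variables (F : finFieldType) (n : nat) (R : idomainType).
Local Notation gT := [the finGroupType of {'GL_n[F]}].
Local Notation G := (FinGroup.sort gT).
Local Notation I := 'I_n.-1.+1.
Local Notation B := (borel F n).
Local Notation U := (unitriangular F n).
Local Notation P_ := (@perm_elt F n).
Local Notation eps := (steinberg_elt F n R : galg R gT).
Local Notation sumU := (@weighted_sum R gT U).
Implicit Types (g h u v : G) (i j k l m : I) (s : 'S_n.-1.+1).
Implicit Types (a b c : F) (lam mu : G -> R) (J : pred I) (chi : F -> R).

Lemma character_vector_mull mu u g : linear_character mu -> u \in U ->
  (sumU mu * eps) (u * g)%g = mu u * (sumU mu * eps) g.
Proof.
by move=> [_ muM]; apply: (@weighted_sum_mul_eigen R gT [group of U]).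
Qed.

Lemma character_vector_mulr mu g h : h \in B ->
  (sumU mu * eps) (g * h)%g = (sumU mu * eps) g.
Proof.
move=> hB; rewrite !weighted_sum_mulE; apply: eq_bigr => u _; congr (_ * _).
by rewrite mulgA steinberg_mulr.
Qed.

(** By the disjointness of the Bruhat cells only the term of s in eps
    contributes. *)
Lemma character_vector_at_perm mu s :
    {in U, forall u, (P_ s * u * (P_ s)^-1)%g \in B -> mu u = 1} ->
  (sumU mu * eps) (P_ s)^-1%g =
  (-1) ^+ s * #|[set u in U | (P_ s * u * (P_ s)^-1)%g \in B]|%:R.
Proof.
move=> mu1; rewrite weighted_sum_mulE -sum1_card natr_sum big_distrr /=.
rewrite [RHS](eq_bigl (fun u => (u \in U) && ((P_ s * u * (P_ s)^-1)%g \in B))).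
  rewrite [RHS]big_mkcondr; apply: eq_bigr => u uU.
  rewrite steinberg_cellE ?unitriangularV //.
  rewrite (mulg_sandwichV (P_ s : gT)) groupV.
  case: ifP => [/(mu1 _ uU)->|_]; first by rewrite mul1r.
  by rewrite !mulr0.
by move=> u; rewrite in_set.
Qed.

Definition longest_perm : 'S_n.-1.+1 := perm (@rev_ord_inj n.-1.+1).
Local Notation w0 := longest_perm.

Lemma longest_permE i : w0 i = rev_ord i. Proof. exact: permE. Qed.

Lemma longest_permV : w0^-1%g = w0.
Proof.
apply/permP=> i; apply: (perm_inj (s := w0)).
by rewrite permKV !longest_permE rev_ordK.
Qed.

Lemma character_vector_at_longest mu : linear_character mu ->
  (sumU mu * eps) (P_ w0) = (-1) ^+ w0.
Proof.
move=> mu_char.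
have triv u : u \in U -> (P_ w0 * u * (P_ w0)^-1)%g \in B -> u = 1%g.
  move=> /unitriangularP[u0 u1] /borelP w0u; apply: GL_eqP => i j.
  rewrite GL_one; have [ij|ji|/val_inj->] := ltngtP i j.
  - have := w0u (rev_ord i) (rev_ord j).
    rewrite perm_elt_conj !longest_permE !rev_ordK => -> /=; last first.
      by have := ltn_ord j; lia.
    by rewrite -val_eqE ltn_eqF.
  - by rewrite u0 // -val_eqE gtn_eqF.
  by rewrite u1 eqxx.
rewrite -{1}longest_permV perm_eltV character_vector_at_perm; last first.
  by move=> u uU /(triv u uU)->; apply: linear_character1.
rewrite [#|_|](_ : _ = 1%N) ?mulr1 // -(cards1 (1%g : G)); congr #|pred_of_set _|.
apply/setP=> u; rewrite in_set in_set1; apply/andP/eqP => [[]|->].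
  exact: triv.
rewrite mulg1 mulgV (group1 (borel_group F n)).
by rewrite (group1 (unitriangular_group F n)).
Qed.

Section BlockDiagonal.
Variable J : pred I.
Local Notation block := (block J).

Definition block_diagonal u : G :=
  to_GL (\matrix_(i, j) if block i == block j then GLval u i j else 0).

Lemma block_diagonalP u : u \in U -> block_diagonal u \in U /\
  forall i j, GLval (block_diagonal u) i j =
    if block i == block j then GLval u i j else 0.
Proof.
move=> /unitriangularP[u0 u1].
have [dU dE] : block_diagonal u \in U /\
    GLval (block_diagonal u) =
    \matrix_(i, j) if block i == block j then GLval u i j else 0.
  apply: to_GL_unitriangular => [i j ji|i]; rewrite !mxE ?eqxx //.
  by rewrite u0 // if_same.
by split=> // i j; rewrite dE mxE.
Qed.

Lemma block_diagonalM u v : u \in U -> v \in U ->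
  block_diagonal (u * v)%g = (block_diagonal u * block_diagonal v)%g.
Proof.
move=> uU vU; have [_ uE] := block_diagonalP uU.
have [_ vE] := block_diagonalP vU.
have [_ uvE] := block_diagonalP (unitriangularM uU vU).
have /unitriangularP[u0 _] := uU; have /unitriangularP[v0 _] := vU.
apply: GL_eqP => i j; rewrite uvE !GL_entryM; case: eqP => [bij|/eqP nbij].
  apply: eq_bigr => k _; rewrite uE vE bij.
  have [bjk|nbjk] := eqVneq (block j) (block k); first by [].
  rewrite mul0r; have [ki|ik] := ltnP k i; first by rewrite u0 ?mul0r.
  have [jk|kj] := ltnP j k; first by rewrite v0 ?mulr0.
  case/eqP: nbjk; apply/eqP; rewrite eqn_leq (block_mono J kj) andbT.
  by rewrite -bij block_mono.
rewrite big1 // => k _; rewrite uE vE.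
case: eqP => [bik|_]; last by rewrite mul0r.
by rewrite -bik (negPf nbij) mulr0.
Qed.

(** The block diagonal part is a homomorphism on U, the projection to the Levi
    subgroup; the other factor lies in its kernel, the unipotent radical. *)
Lemma block_factor u : u \in U -> exists v, [/\ v \in U,
  u = (block_diagonal u * v)%g &
  forall i j, block i = block j -> GLval v i j = (i == j)%:R].
Proof.
move=> uU; have [dU dE] := block_diagonalP uU.
pose v := ((block_diagonal u)^-1 * u)%g.
have vU : v \in U by rewrite unitriangularM ?unitriangularV.
exists v; split=> // [|i j bij]; first by rewrite mulKVg.
have dv1 : block_diagonal v = 1%g.
  have := block_diagonalM dU vU; rewrite mulKVg.
  have -> : block_diagonal (block_diagonal u) = block_diagonal u.
    apply: GL_eqP => k l; have [_ ->] := block_diagonalP dU.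
    by rewrite dE; case: eqP.
  by move/(congr1 (mulg (block_diagonal u)^-1%g)); rewrite mulVg mulKg.
have [_ /(_ i j)] := block_diagonalP vU.
by rewrite dv1 GL_one bij eqxx.
Qed.

End BlockDiagonal.
End DegenerateCharacters.

Section RemoveSimpleRoots.
Variables (F : finFieldType) (n : nat) (R : idomainType).
Local Notation gT := [the finGroupType of {'GL_n[F]}].
Local Notation G := (FinGroup.sort gT).
Local Notation I := 'I_n.-1.+1.
Local Notation B := (borel F n).
Local Notation U := (unitriangular F n).
Local Notation P_ := (@perm_elt F n).
Local Notation eps := (steinberg_elt F n R : galg R gT).
Local Notation sumU := (@weighted_sum R gT U).
Local Notation w0 := (longest_perm n).
Variables (chi : F -> R) (chi_char : additive_character chi) (J : pred I).
Implicit Types (g h u v : G) (i j k l m : I).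
Local Notation block := (block J).
Local Notation r := (block_reversal J).
Local Notation s := (block_reversal J)^-1%g.

Definition indicator j : F := (J j)%:R.
Local Notation mu := (simple_character chi indicator : G -> R).
Local Notation lam := (simple_character chi (fun=> 1) : G -> R).

(** The reversal makes the simple roots in J negative. *)
Lemma simple_character_reversal_trivial u :
  (P_ s * u * (P_ s)^-1)%g \in B -> mu u = 1.
Proof.
move=> /borelP u0; case: chi_char => chi0 _; rewrite /simple_character.
rewrite /superdiagonal big1 ?chi0 // => -[i j] /= /eqP ji.
rewrite /indicator -(block_succ J ji); case: eqP => [bij|]; last by rewrite mul0r.
have ij : (i < j)%N by rewrite ji.
have := u0 _ _ (block_reversal_inside ij bij).
by rewrite perm_elt_conj !permK => ->; rewrite mulr0.
Qed.

Lemma block_reversal_conj_borel v : v \in U ->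
    (forall i j, block i = block j -> GLval v i j = (i == j)%:R) ->
  (P_ s * v * (P_ s)^-1)%g \in B.
Proof.
move=> /unitriangularP[v0 _] vblock; apply/borelP=> k l lk.
rewrite perm_elt_conj; set i := s k; set j := s l.
have [ki lj] : k = r i /\ l = r j by rewrite !permKV.
rewrite ki lj in lk *; have [ij|ji|/val_inj ij] := ltngtP i j; last first.
- by rewrite ij ltnn in lk.
- exact: v0.
have [bij|bij|bij] := ltngtP (block i) (block j).
- by have := block_reversal_across bij; rewrite ltnNge ltnW.
- by have := block_mono J (ltnW ij); rewrite leqNgt bij.
by rewrite vblock // -val_eqE ltn_eqF.
Qed.

Lemma longest_perm_ltn k l : (w0 k < w0 l)%N = (l < k)%N.
Proof.
rewrite !longest_permE /=; have := ltn_ord k; have := ltn_ord l; lia.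
Qed.

Lemma longest_perm_succ k l : (w0 l == (w0 k).+1 :> nat) = (k == l.+1 :> nat).
Proof.
rewrite !longest_permE /=; have := ltn_ord k; have := ltn_ord l; lia.
Qed.

Lemma longest_permK : involutive w0.
Proof. by move=> k; rewrite !longest_permE rev_ordK. Qed.

(** Reversing each block and then everything moves the blocks around and keeps
    the order inside each of them: simple roots in J are carried to simple
    roots, and the block diagonal part of U into U. *)
Lemma block_diagonal_transport v (x := (P_ w0 * P_ s)%g)
    (z := (x * block_diagonal J v * x^-1)%g) :
  v \in U -> z \in U /\ lam z = mu v.
Proof.
move=> vU; have [dU dE] := block_diagonalP J vU.
have /unitriangularP[v0 v1] := vU.
have zE k l : GLval z (w0 (r k)) (w0 (r l)) = GLval (block_diagonal J v) k l.
  by rewrite /z /x -perm_eltM perm_elt_conj !permM !longest_permK !permK.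
have zE' k l : GLval z k l = GLval (block_diagonal J v) (s (w0 k)) (s (w0 l)).
  by rewrite -zE !permKV !longest_permK.
split.
  apply/unitriangularP; split=> [k l lk|k]; rewrite zE' dE; last by rewrite eqxx.
  case: eqP => // bij; set i := s (w0 k) in bij *; set j := s (w0 l) in bij *.
  have [ij|ji|/val_inj ij] := ltngtP i j; last first.
  - by move: lk; rewrite -longest_perm_ltn -[w0 k](permKV r) -/i ij permKV ltnn.
  - exact: v0.
  have := block_reversal_inside ij bij.
  by rewrite !permKV longest_perm_ltn ltnNge ltnW.
rewrite /simple_character /superdiagonal; congr chi.
rewrite big_mkcond [RHS]big_mkcond.
have h_inj : injective (fun p : I * I => (w0 (r p.1), w0 (r p.2))).
  by move=> [? ?] [? ?] [/perm_inj/perm_inj-> /perm_inj/perm_inj->].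
rewrite (reindex_inj h_inj); apply: eq_bigr => -[i j] _ /=.
rewrite mul1r zE dE longest_perm_succ /indicator.
have [ij|ji|/val_inj->] := ltngtP i j; last first.
- by rewrite !ltn_eqF.
- rewrite v0 // if_same mulr0 if_same; by rewrite if_same.
have [bij|bij] := eqVneq (block i) (block j).
  rewrite block_reversal_adjacent //; case: eqP => // ji.
  by rewrite -(block_succ J ji) bij eqxx mul1r.
rewrite if_same; case: eqP => // ji.
by rewrite -(block_succ J ji) (negPf bij) mul0r.
Qed.

(** The radical part of v is absorbed on the right by B, and the block diagonal
    part comes out on the left through the equivariance under U. *)
Lemma regular_vector_at_reversal v : v \in U ->
  (sumU lam * eps) (P_ w0 * (P_ s * v * (P_ s)^-1))%g = mu v * (-1) ^+ w0.
Proof.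
move=> vU; have [v' [v'U vE v'block]] := block_factor J vU.
have [zU zlam] := block_diagonal_transport vU.
have lam_char := simple_character_linear (fun=> 1 : F) chi_char.
rewrite {1}vE mulg_twist character_vector_mull // zlam.
by rewrite character_vector_mulr ?character_vector_at_longest //
           block_reversal_conj_borel.
Qed.

(** For the product g of the two reversals, s(mu) g E(lam) = c E(mu) for some
    scalar c.  Evaluation at the block reversal shows that c divides the order
    of U up to sign, hence is a unit. *)
Lemma simple_character_degenerate (lam0 : G -> R) (x : (galg R gT)^o) :
    parabolic lam0 = [set: G] -> (#|U|%:R : R) \is a GRing.unit ->
    sumU lam * eps \in cyclic_sub x ->
  sumU mu * eps \in cyclic_sub x.
Proof.
move=> Plam0 cardU xlam.
have mu_char := simple_character_linear indicator chi_char.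
pose g : G := ((P_ w0 * P_ s)^-1)%g.
have [c] := eigenspace_span (gelt R g * sumU lam) Plam0 mu_char.
rewrite -mulrA => cE.
have : #|U|%:R * (-1) ^+ w0 = c * (sumU mu * eps) (P_ s)^-1%g.
  transitivity ((c *: (sumU mu * eps)) (P_ s)^-1%g); last by rewrite ffunE.
  rewrite -cE weighted_sum_mulE -sum1_card natr_sum big_distrl /=.
  apply: eq_bigr => v vU; rewrite gelt_mulE invgK mul1r -!mulgA mulgA -mulgA.
  rewrite [X in _ (_ * X)%g]mulgA regular_vector_at_reversal ?unitriangularV //.
  rewrite mulrA -(mu_char.2 v) ?unitriangularV //.
  by rewrite mulgV linear_character1 ?mul1r.
rewrite character_vector_at_perm => [cardUE|u uU]; last first.
  exact: simple_character_reversal_trivial.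
have cU : c \is a GRing.unit.
  have : #|U|%:R * (-1) ^+ w0 \is a @GRing.unit R.
    by rewrite unitrM cardU unitrX ?unitrN1.
  by rewrite cardUE unitrM => /andP[].
have -> : sumU mu * eps = c^-1 *: (sumU mu * (gelt R g * (sumU lam * eps))).
  by rewrite cE scalerA mulVr // scale1r.
by apply: cyclic_sub_scale; apply: cyclic_subM; apply: cyclic_subM.
Qed.

End RemoveSimpleRoots.

(** * Descent through the columns *)

Section ColumnFiltration.
Variables (F : finFieldType) (n : nat).
Local Notation gT := [the finGroupType of {'GL_n[F]}].
Local Notation G := (FinGroup.sort gT).
Local Notation I := 'I_n.-1.+1.
Local Notation U := (unitriangular F n).
Local Notation P_ := (@perm_elt F n).
Implicit Types (g h u v : G) (i j m : I) (k : nat).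

Definition column_subgroup k : {set G} :=
  [set u in U | [forall i : I, forall j : I,
     (j < k)%N ==> (GLval u i j == (i == j)%:R)]].

Lemma column_subgroupP k u :
  reflect (u \in U /\ forall i j, (j < k)%N -> GLval u i j = (i == j)%:R)
          (u \in column_subgroup k).
Proof.
apply: (iffP setIdP) => -[uU uk]; split=> //.
  by move=> i j jk; apply/eqP; move/forallP/(_ i)/forallP/(_ j)/implyP/(_ jk): uk.
by apply/forallP=> i; apply/forallP=> j; apply/implyP=> jk; rewrite uk.
Qed.

Lemma column_subgroup0 : column_subgroup 0 = U.
Proof. by apply/setP=> u; apply/column_subgroupP/idP => [[]|]. Qed.

Lemma column_subgroup_full : column_subgroup n.-1.+1 = [set 1%g].
Proof.
apply/setP=> u; rewrite in_set1; apply/column_subgroupP/eqP => [[_ u1]|->].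
  by apply: GL_eqP => i j; rewrite u1 // GL_one.
by split=> [|i j _]; rewrite ?GL_one // (group1 (unitriangular_group F n)).
Qed.

Lemma column_subgroupS (k : I) u :
  (u \in column_subgroup k.+1) =
  (u \in column_subgroup k) && [forall i, GLval u i k - (i == k)%:R == 0].
Proof.
apply/column_subgroupP/andP => [[uU u1]|[/column_subgroupP[uU u1] /forallP uk]].
  split; first by apply/column_subgroupP; split=> // i j jk; rewrite u1 // ltnW.
  by apply/forallP=> i; rewrite u1 // subrr.
split=> // i j; rewrite ltnS leq_eqVlt => /orP[/eqP/val_inj->|]; last exact: u1.
by apply/eqP; rewrite -subr_eq0.
Qed.

Definition upper_left_GL k : {set G} :=
  [set g : G | [forall i : I, forall j : I,
     (k <= i)%N || (k <= j)%N ==> (GLval g i j == (i == j)%:R)]].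

Lemma upper_left_GLP k g :
  reflect (forall i j, (k <= i)%N || (k <= j)%N -> GLval g i j = (i == j)%:R)
          (g \in upper_left_GL k).
Proof.
rewrite in_set; apply: (iffP forallP) => [gk i j ijk|gk i].
  by apply/eqP; move/forallP/(_ j)/implyP/(_ ijk): (gk i).
by apply/forallP=> j; apply/implyP=> ijk; rewrite gk.
Qed.

Lemma upper_left_GL_group_set k : group_set (upper_left_GL k).
Proof.
apply/group_setP; split=> [|g h /upper_left_GLP gk /upper_left_GLP hk].
  by apply/upper_left_GLP=> i j _; rewrite GL_one.
apply/upper_left_GLP=> i j; rewrite GL_entryM; case/orP => [ki|kj].
  rewrite (bigD1 i) //= gk ?ki // eqxx mul1r hk ?ki // big1 ?addr0 // => m mi.
  by rewrite gk ?ki // eq_sym (negPf mi) mul0r.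
rewrite (bigD1 j) //= hk ?kj ?orbT // eqxx mulr1 gk ?kj ?orbT //.
rewrite big1 ?addr0 // => m mj.
by rewrite hk ?kj ?orbT // (negPf mj) mulr0.
Qed.
Canonical upper_left_GL_group k := Group (upper_left_GL_group_set k).

(** This is the transitivity of GL_k on nonzero linear forms. *)
Lemma upper_left_GL_row (k l m : I) (c : I -> F) :
    k = l.+1 :> nat -> (m < k)%N -> c m != 0 ->
  exists2 h, h \in upper_left_GL k &
    forall j, GLval h l j = if (j < k)%N then c j else 0.
Proof.
move=> kl mk cm; pose w j := if (j < k)%N then c j else 0.
have wm : w m = c m by rewrite /w mk.
pose A : 'M[F]_n.-1.+1 := \matrix_(i, j) if i == m then w j else (i == j)%:R.
pose A' : 'M[F]_n.-1.+1 := \matrix_(i, j)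
  if i == m then (if j == m then 1 else - w j) / c m else (i == j)%:R.
have AA' : A *m A' = 1%:M.
  apply/matrixP=> i j; rewrite !mxE (bigD1 i) //= !mxE.
  have [->|im] := eqVneq i m; last first.
    rewrite eqxx mul1r big1 ?addr0 // => r /negPf ri.
    by rewrite !mxE (negPf im) eq_sym ri mul0r.
  rewrite wm mulrC divfK //.
  under eq_bigr => r rm do rewrite !mxE eqxx (negPf rm).
  have [->|jm] := eqVneq j m.
    by rewrite big1 ?addr0 // => r /negPf rm; rewrite rm mulr0.
  rewrite (bigD1 j) //= eqxx mulr1 addrA addNr add0r big1 //.
  by move=> r /andP[_ /negPf rj]; rewrite rj mulr0.
have [AU _] := mulmx1_unit AA'.
(* The row l becomes c: A puts c in the row m, the transposition moves it. *)
have lk : (l < k)%N by rewrite kl.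
exists (P_ (tperm m l) * to_GL A)%g => [|j]; last first.
  by rewrite perm_elt_mull tpermR to_GL_K // mxE eqxx.
apply: (groupM (G := upper_left_GL_group k)); apply/upper_left_GLP=> i j.
  rewrite perm_eltE; case/orP=> [ki|kj].
    by rewrite tpermD //; apply: contraTneq ki => <-; rewrite -ltnNge.
  rewrite -(inj_eq (@perm_inj _ (tperm m l))) tpermK.
  by rewrite tpermD //; apply: contraTneq kj => <-; rewrite -ltnNge.
rewrite to_GL_K // mxE; have [->|//] := eqVneq i m.
rewrite leqNgt mk /= => kj; rewrite /w ltnNge kj /=.
by case: eqP kj => // <-; rewrite leqNgt mk.
Qed.

Lemma column_subgroup_conj k h u : h \in upper_left_GL k ->
    u \in column_subgroup k ->
  (u ^ h)%g \in column_subgroup k /\ forall i j, (k <= j)%N ->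
    GLval (u ^ h)%g i j = if (k <= i)%N then GLval u i j else
      \sum_(m : I | (m < k)%N) GLval h^-1%g i m * GLval u m j.
Proof.
move=> hk /column_subgroupP[/unitriangularP[u0 u1] uk].
have /upper_left_GLP hE := hk.
have /upper_left_GLP hVE : (h^-1)%g \in upper_left_GL k.
  exact: (groupVr (G := upper_left_GL_group k)).
have right i j : (k <= j)%N ->
    GLval (u ^ h)%g i j = if (k <= i)%N then GLval u i j else
      \sum_(m : I | (m < k)%N) GLval h^-1%g i m * GLval u m j.
  move=> kj; rewrite conjgE mulgA GL_entryM.
  rewrite (big_only1 j) // => [|m mj _]; last first.
    by rewrite hE ?kj ?orbT // (negPf mj) mulr0.
  rewrite hE ?kj ?orbT // eqxx mulr1 GL_entryM; case: leqP => [ki|ik].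
    rewrite (big_only1 i) // => [|m mi _]; first by rewrite hVE ?ki // eqxx mul1r.
    by rewrite hVE ?ki // eq_sym (negPf mi) mul0r.
  rewrite [RHS]big_mkcond; apply: eq_bigr => m _; case: ltnP => // km.
  by rewrite hVE ?km ?orbT //; case: eqP km => [<-|]; rewrite ?mul0r // leqNgt ik.
have left i j : (j < k)%N -> GLval (u ^ h)%g i j = (i == j)%:R.
  move=> jk; rewrite -GL_one -(mulVg h) conjgE !GL_entryM.
  apply: eq_bigr => m _; congr (_ * _); rewrite GL_entryM.
  rewrite (big_only1 m) // => [|r rm _]; first by rewrite u1 mul1r.
  have [rk|kr] := ltnP r k; first by rewrite uk // eq_sym (negPf rm) mul0r.
  by rewrite hE ?kr //; case: eqP jk => [<-|]; rewrite ?mulr0 // ltnNge kr.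
split=> //; apply/column_subgroupP; split=> //; apply/unitriangularP.
split=> [i j ji|i].
  have [jk|kj] := ltnP j k; first by rewrite left // -val_eqE gtn_eqF.
  by rewrite right // (leq_trans kj (ltnW ji)) u0.
have [ik|ki] := ltnP i k; first by rewrite left // eqxx.
by rewrite right // ki u1.
Qed.

End ColumnFiltration.

Section FourierDescent.
Variables (F : finFieldType) (n : nat) (R : idomainType).
Local Notation gT := [the finGroupType of {'GL_n[F]}].
Local Notation G := (FinGroup.sort gT).
Local Notation I := 'I_n.-1.+1.
Local Notation U := (unitriangular F n).
Local Notation eps := (steinberg_elt F n R : galg R gT).
Local Notation U_ := (@column_subgroup F n).
Local Notation ws := (@weighted_sum R gT).
Variables (chi : F -> R) (chi_char : additive_character chi).
Hypothesis chi_nt : exists a, chi a != 1.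
Implicit Types (g h u v : G) (i j m : I) (J : pred I) (c : I -> F).
Local Notation theta J := (simple_character chi (indicator F J) : G -> R).

(** The coefficients c run over all characters of the column k, its diagonal
    entry being shifted to 0; the columns beyond k carry theta J. *)
Definition column_character (k : I) J c u : R :=
  chi (superdiagonal (indicator F [pred j | J j && (k < j)%N]) u +
       \sum_i c i * (GLval u i k - (i == k)%:R)).

(** Fourier inversion in the column k. *)
Lemma column_character_sum (k : I) J :
  \sum_(c : {ffun I -> F}) ws (U_ k) (column_character k J c) =
  (#|F|%:R ^+ #|I|) *: ws (U_ k.+1) (theta J).
Proof.
have [chi0 chiD] := chi_char.
rewrite exchange_big scaler_sumr /=.
rewrite [RHS](eq_bigl (fun u => (u \in U_ k) &&
    [forall i, GLval u i k - (i == k)%:R == 0])); last exact: column_subgroupS.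
rewrite [RHS]big_mkcondr; apply: eq_bigr => u /column_subgroupP[_ u1] /=.
rewrite -scaler_suml.
under eq_bigr => c _ do rewrite /column_character chiD.
rewrite -big_distrr additive_character_orthogonality //=.
case: ifP => [/forallP uk|_]; last by rewrite !mulr0 scale0r.
rewrite mulr1 mulrC -scalerA; congr (_ *: (chi _ *: _)).
apply: eq_bigr => -[i j] /= /eqP ji; rewrite /indicator /=.
have [kj|] := ltnP k j; first by rewrite andbT.
rewrite andbF leq_eqVlt => /orP[/eqP/val_inj jk|jk].
  have := uk i; rewrite -jk subr_eq0 => /eqP->.
  by rewrite -val_eqE /= ji ltn_eqF // !mulr0.
by rewrite u1 // -val_eqE /= ji ltn_eqF // !mulr0.
Qed.

(** A character of the column k is trivial, or conjugate under GL_k to the one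
    that only sees the entry just above the diagonal; both are of the form
    theta J' on U_k. *)
Lemma column_character_conj (k : I) J c :
  (exists J', ws (U_ k) (column_character k J c) = ws (U_ k) (theta J')) \/
  (exists h J', ws (U_ k) (column_character k J c) =
     gelt R h * ws (U_ k) (theta J') * gelt R h^-1%g).
Proof.
have truncate u : u \in U_ k ->
    \sum_i c i * (GLval u i k - (i == k)%:R) =
    \sum_(i : I | (i < k)%N) c i * GLval u i k.
  move=> /column_subgroupP[/unitriangularP[u0 u1] _].
  rewrite [RHS]big_mkcond; apply: eq_bigr => i _.
  have [ik|ki|/val_inj->] := ltngtP i k.
  - by rewrite -val_eqE /= ltn_eqF // subr0.
  - by rewrite u0 // -val_eqE /= gtn_eqF // subr0 mulr0.
  by rewrite u1 eqxx subrr mulr0.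
case: (boolP [exists m : I, (m < k)%N && (c m != 0)]) => [|no_m].
  case/existsP=> m /andP[mk cm]; right.
  have ltl : (k.-1 < n.-1.+1)%N.
    by apply: leq_ltn_trans (ltn_ord k); apply: leq_pred.
  pose l : I := Ordinal ltl.
  have kl : k = l.+1 :> nat by apply/esym/prednK; apply: leq_ltn_trans mk.
  have [y yk yl] := upper_left_GL_row kl mk cm.
  have hk : (y^-1)%g \in upper_left_GL F n k.
    exact: (groupVr (G := upper_left_GL_group F n k)).
  exists (y^-1)%g, [pred j | (J j && (k < j)%N) || (j == k)].
  rewrite -weighted_sum_conj => [|u uk]; last first.
    by have [] := column_subgroup_conj hk uk.
  apply: eq_bigr => u uk; congr (chi _ *: _).
  have [_] := column_subgroup_conj hk uk.
  rewrite invgK; move: (u ^ _)%g => v vE.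
  rewrite truncate // /superdiagonal (bigD1 (l, k)) /= ?kl //.
  rewrite [X in _ = X](bigD1 (l, k)) /= ?kl // /indicator /= -kl.
  rewrite ltnn andbF eqxx mul0r mul1r add0r [RHS]addrC; congr (_ + _); last first.
    have -> : GLval v l k = \sum_(m : I | (m < k)%N) GLval y l m * GLval u m k.
      by rewrite vE // leqNgt kl ltnSn.
    apply: eq_bigr => i ik.
    by rewrite yl ik.
  apply: eq_bigr => -[i j] /= /andP[/eqP ji]; rewrite xpair_eqE => ne_lk.
  have [kj|jk] := ltnP k j.
    by rewrite vE ?(ltnW kj) // -ltnS -ji kj andbT -val_eqE /= gtn_eqF ?orbF.
  rewrite !andbF !mul0r /=; case: eqP => [jk'|]; last by rewrite mul0r.
  case/negP: ne_lk; rewrite jk' eqxx andbT -(inj_eq val_inj) /=.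
  by rewrite -eqSS -ji -kl jk'.
left; exists [pred j | J j && (k < j)%N].
apply: eq_bigr => u uk; congr (chi _ *: _); rewrite truncate // big1 ?addr0 //.
move=> i ik; apply/eqP; rewrite mulf_eq0; apply/orP; left.
by apply: contraNT no_m => ci; apply/existsP; exists i; rewrite ik.
Qed.

(** Linear characters of U, degenerate ones included, detect every vector: the
    columns are removed one at a time from U until only 1 is left. *)
Lemma fourier_descent (lam : G -> R) (x : (galg R gT)^o) :
    parabolic lam = [set: G] -> (#|F|%:R : R) \is a GRing.unit ->
    (forall J, ws U (theta J) * eps \in cyclic_sub x) ->
  eps \in cyclic_sub x.
Proof.
move=> Plam qU xJ.
have descent k : (k <= n.-1.+1)%N -> forall J g,
    ws (U_ k) (theta J) * (gelt R g * eps) \in cyclic_sub x.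
  elim: k => [_ J g|k IHk lt_k J g].
    rewrite column_subgroup0.
    have theta_char := simple_character_linear (indicator F J) chi_char.
    have [c ->] := eigenspace_span (gelt R g) Plam theta_char.
    exact: cyclic_sub_scale.
  pose k' : I := Ordinal lt_k.
  have q_unit : #|F|%:R ^+ #|I| \is a @GRing.unit R by rewrite unitrX.
  have -> : ws (U_ k.+1) (theta J) = (#|F|%:R ^+ #|I|)^-1 *:
      \sum_(c : {ffun I -> F}) ws (U_ k') (column_character k' J c).
    by rewrite column_character_sum scalerA mulVr // scale1r.
  rewrite -galg_scaleAl; apply: cyclic_sub_scale.
  rewrite big_distrl; apply: rpred_sum => c _ /=.
  have [[J' ->]|[h [J' ->]]] := column_character_conj k' J c.
    exact: IHk (ltnW lt_k) _ _.
  rewrite -!mulrA (gelt_mulA h^-1%g); apply: cyclic_subM.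
  exact: IHk (ltnW lt_k) _ _.
have := descent _ (leqnn _) pred0 1%g.
rewrite column_subgroup_full /weighted_sum big_set1 gelt1_mul.
have theta_char :=
  simple_character_linear (indicator F (pred0 : pred I)) chi_char.
by rewrite linear_character1 // scale1r gelt1_mul.
Qed.

End FourierDescent.

(** * The theorem *)

Theorem theorem4p8 (F : finFieldType) (n p l : nat) (R : idomainType)
    (lam : {'GL_n[F]} -> R)
    (n_ge2 : (2 <= n)%N)
    (charF : p \in [pchar F])
    (l_prime : prime l) (l_neq_p : l != p)
    (charR : [pchar R] =i pred0)
    (pidR : principal_ideal_domain R)
    (localR : local_with_maximal_ideal_generated_by (l%:R : R))
    (rootR : exists z : R, p.-primitive_root z)
    (lam_hom : linear_character lam)
    (Plam : parabolic lam = [set: {'GL_n[F]}]) :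
  cyclic_sub (E_lambda lam) =i cyclic_sub (steinberg_elt F n R) /\
  cyclic_sub (F_lambda l lam) =i predT.
Proof.
have p_pr := pcharf_prime charF.
have pU : (p%:R : R) \is a GRing.unit.
  apply: local_natr_unit localR _ _; rewrite ?prime_gt0 // prime_coprime //.
  by rewrite dvdn_prime2 // eq_sym.
have qU : (#|F|%:R : R) \is a GRing.unit by apply: card_finField_unit charF pU.
have cardU : (#|unitriangular F n|%:R : R) \is a GRing.unit.
  have := card_pgroup (unitriangular_pgroup n charF) => /= ->.
  by rewrite natrX unitrX.
have q0 : #|F|%:R != 0 :> R by apply: contraTneq qU => ->; rewrite unitr0.
have E_def : E_lambda lam =
    weighted_sum (unitriangular F n) lam * steinberg_elt F n R.
  by rewrite weighted_sumMl.
have eps_in : steinberg_elt F n R \in cyclic_sub (E_lambda lam).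
  have lam_nt (i j : 'I_n.-1.+1) : j = i.+1 :> nat ->
      exists a, lam (root_elt i j a) != 1.
    by move=> ji; apply: parabolic_full_nontrivial Plam.
  have [chi [t [chi_char chi_nt t0 lamE]]] :=
    linear_character_simple n_ge2 lam_hom lam_nt q0.
  apply: (fourier_descent chi_char chi_nt Plam qU) => J.
  apply: (simple_character_degenerate chi_char J Plam cardU).
  apply: (simple_character_normalize t0).
  apply/cyclic_subP; exists 1; rewrite scale1r E_def; congr (_ * _).
  by apply: eq_bigr => u uU; rewrite lamE.
have [b bE] := cyclic_subP _ _ eps_in.
split=> [x|y]; last rewrite inE.
  apply/cyclic_subP/cyclic_subP => -[a ->].
    exists (a * weighted_sum (unitriangular F n) lam).
    by rewrite E_def; apply: mulrA.
  by exists (a * b); rewrite bE; apply: scalerA.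
apply/cyclic_subP; rewrite -[y]red_reprK.
have [a aE] := cyclic_subP _ _ (cyclic_valP (red_repr y)).
exists (galg_red l (a * b)).
have -> : red_repr y = (a * b) *: E_lambda_lattice lam.
  by apply: val_inj; rewrite /= aE bE; apply: scalerA.
exact/esym/red_scaleE.
Qed.
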